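(* Let $p\ge 3$ be a prime and $k$ a positive integer with $p\nmid k$, and let $\phi_{(p,k)}(x)=x^p+kpx^{p-1}-kp\in\mathbb{Z}[x]$. If $p\ge 5$ and $k\equiv 1 \pmod 3$, then $G_{\mathbb{Q}}(\phi_{(p,k)})=\mathrm{Aut}(T_\infty)$. Moreover, $G_{\mathbb{Q}}(\phi_{(3,2)})=\mathrm{Aut}(T_\infty)$, where $\phi_{(3,2)}(x)=x^3+6x^2-6$. Consequently, for every prime $\ell$ there exists a polynomial $\varphi\in\mathbb{Z}[x]$ of degree $\ell$ with $G_{\mathbb{Q}}(\varphi)=\mathrm{Aut}(T_\infty)$.
   Context: For a number field $K$ and $\varphi\in K[x]$ of degree $d\ge 2$ such that every iterate $\varphi^n$ ($n\ge1$, $\varphi^n$ the $n$-fold composition) is separable, the pre-image tree $T_\infty$ has vertex set $\bigsqcup_{n\ge 0}\varphi^{-n}(0)$ (with $\varphi^{-0}(0)=\{0\}$), and $\alpha\in\varphi^{-n}(0)$, $\beta\in\varphi^{-(n+1)}(0)$ are joined by an edge iff $\varphi(\beta)=\alpha$. $\mathrm{Aut}(T_\infty)$ is its graph automorphism group (isomorphic to the infinite iterated wreath product of $S_d$). The absolute Galois group $\mathrm{Gal}(\overline{K}/K)$ acts on $T_\infty$ through its action on the sets $\varphi^{-n}(0)$, giving a homomorphism $\rho:\mathrm{Gal}(\overline K/K)\to\mathrm{Aut}(T_\infty)$; $G_K(\varphi)$ denotes its image. *)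

(* Defs.v *)
From HB Require Import structures.
From mathcomp Require Import all_boot all_order all_algebra.
From mathcomp Require Import separable algC.
Set Implicit Arguments. Unset Strict Implicit. Unset Printing Implicit Defensive.
Import GRing.Theory Num.Theory.
Local Open Scope ring_scope.

(* algC (algebraic complex numbers) plays the role of an algebraic closure
   of Q; Gal(Qbar/Q) = bijective ring endomorphisms of algC. *)

Definition iter_poly (phi : {poly int}) (n : nat) : {poly int} :=
  iter n (fun q => phi \Po q) 'X.

Definition qbar (phi : {poly int}) : {poly algC} := map_poly intr phi.

(* vertices of T_infty: pairs (n, a) with a a root of phi^n (disjoint union) *)
Definition tree_vertex (phi : {poly int}) :=
  {v : nat * algC | root (qbar (iter_poly phi v.1)) v.2}.

Definition tree_adj (phi : {poly int}) (u v : tree_vertex phi) : Prop :=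
  ((val v).1 = (val u).1.+1 /\ (qbar phi).[(val v).2] = (val u).2) \/
  ((val u).1 = (val v).1.+1 /\ (qbar phi).[(val u).2] = (val v).2).

Definition tree_aut (phi : {poly int}) (f : tree_vertex phi -> tree_vertex phi) : Prop :=
  bijective f /\ forall u v, tree_adj u v <-> tree_adj (f u) (f v).

(* f lies in G_Q(phi), the image of rho : Gal(Qbar/Q) -> Aut(T_infty) *)
Definition gal_image (phi : {poly int}) (f : tree_vertex phi -> tree_vertex phi) : Prop :=
  exists2 s : {rmorphism algC -> algC}, bijective s &
    forall v, val (f v) = ((val v).1, s (val v).2).

Definition full_arboreal (phi : {poly int}) : Prop :=
  (forall n, separable_poly (qbar (iter_poly phi n.+1))) /\
  (forall f : tree_vertex phi -> tree_vertex phi, gal_image f <-> tree_aut f).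

Definition phi_pk (p k : nat) : {poly int} :=
  ('X^p + (((k * p)%N)%:R : int)%:P * 'X^(p.-1) - (((k * p)%N)%:R : int)%:P)%R.

(* Main.v *)
From HB Require Import structures.
Require Import Defs.
From mathcomp Require Import all_boot all_order all_algebra.
From mathcomp Require Import fingroup all_field.
From mathcomp Require Import boolp classical_sets filter.
From mathcomp Require Import ring zify.
Set Implicit Arguments. Unset Strict Implicit. Unset Printing Implicit Defensive.
Import Order.TTheory GRing.Theory Num.Theory.
Local Open Scope classical_set_scope.
Local Open Scope ring_scope.

(* phi has the critical points 0 and crit = -k(p-1), and 0 -> -kp -> -kp, so the
   integers phi^n(crit) are pairwise coprime away from kp.  Moreover phi^n(crit)/k is
   prime to kp and not a square up to sign, by a congruence modulo 3, modulo 8 for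
   (p, k) = (3, 2), and modulo 4 for (p, k) = (2, 3), which settles degree 2.  So some
   prime q not dividing kp divides phi^n(crit) to an odd power; phi^n has exactly one double
   root modulo a prime above q, and an inertia element there transposes two roots of
   phi^n and fixes all the others.  phi^n is Eisenstein at p, so the Galois group is
   transitive on its roots; hence "being exchanged by a Galois transposition" cuts the
   fibers of phi, which have p elements, into classes of one common size at least 2.
   The size divides p, so all fiberwise permutations occur.

   The inertia element is obtained without ramification theory.  Let delta^2 = D in Z
   with odd valuation at q, let Theta be the polynomial whose coefficients are the
   roots, and let N(X) be the product of X - s(Theta) over the s fixing delta.  For t
   with t(delta) = -delta, N and t(N) are congruent modulo a prime P above q because
   the fixed field of the stabiliser of delta is ramified; as N(Theta) = 0 and P[T] is
   prime, some t s(Theta) is congruent to Theta. *)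

(** * Galois descent from [algC] to the rationals *)

Lemma Crat_fixed_splitting (L : splittingFieldType rat)
    (LC : {rmorphism L -> algC}) (x : L) :
  (forall s : {rmorphism algC -> algC}, s (LC x) = LC x) -> LC x \in Crat.
Proof.
move=> fix_x; have galL : galois 1 {:L}.
  apply/and3P; split; [exact: sub1v | | exact: normalFieldf].
  apply/separableP => y _; apply: pcharf0_separable => q.
  by rewrite pchar_lalg pchar_num.
have : x \in (1%AS : {subfield L}).
  have/galois_fixedField <- := galL; apply/fixedFieldP; first exact: memvf.
  (* Each element of the Galois group of [L] extends to an automorphism of [algC], so [x] lies in
     the fixed field of that group. *)
  move=> g _; have [nu Dnu] := extend_algC_subfield_aut LC (g : 'AEnd(L)).
  by apply: (fmorph_inj LC); rewrite Dnu.
by move=> /vlineP[a ->]; rewrite rmorphZ_num rmorph1 mulr1 Crat_rat.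
Qed.

(** The roots of the minimal polynomial of [x] generate a splitting field inside [algC], where the
    Galois correspondence applies. *)
Lemma Crat_fixed (x : algC) :
  (forall s : {rmorphism algC -> algC}, s x = x) -> x \in Crat.
Proof.
move=> fix_x.
have [p [Dp mon_p] dv_p] := minCpolyP x.
have [r Dr] := closed_field_poly_normal (map_poly (ratr : rat -> algC) p).
rewrite lead_coef_map (monicP mon_p) rmorph1 scale1r in Dr.
have rx : x \in r by rewrite -root_prod_XsubC -Dr dv_p.
have [Qr [QrC [rr Drr genQr]]] := num_field_exists r.
have [xx Dxx] : exists xx, QrC xx = x.
  by move: rx; rewrite -Drr => /mapP[xx _ ->]; exists xx.
have splitQr : SplittingField.axiom Qr.
  exists (map_poly (in_alg Qr) p).
    by apply/polyOverP=> i; rewrite coef_map memvZ ?memv_line.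
  exists rr => //; congr (_ %= _): (eqpxx (map_poly (in_alg Qr) p)).
  apply/(map_poly_inj QrC); rewrite -map_poly_comp.
  rewrite (@eq_map_poly _ _ _ ratr) => [|a]; last first.
    by rewrite /= rmorphZ_num rmorph1 mulr1.
  rewrite Dr -Drr big_map rmorph_prod /=.
  by apply: eq_bigr => z _; rewrite map_polyXsubC.
pose spM := FieldExt_isSplittingField.Build rat Qr splitQr.
pose L : splittingFieldType rat := HB.pack Qr spM.
rewrite -Dxx; apply: (@Crat_fixed_splitting L QrC xx) => s.
by rewrite Dxx fix_x.
Qed.

(** * Prime ideals of the ring of algebraic integers *)

(** A prime ideal, lying above q, of the ring of all algebraic integers, given as a predicate;
    reduction modulo q then needs no choice of a number field. *)
Record prime_above (q : nat) (P : algC -> Prop) : Prop := PrimeAbove {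
  prime_above_Aint : forall x, P x -> x \in Aint;
  prime_aboveD : forall x y, P x -> P y -> P (x + y);
  prime_aboveMl : forall a x, a \in Aint -> P x -> P (a * x);
  prime_above_self : P q%:R;
  prime_above_proper : ~ P 1;
  prime_above_prime : forall x y, x \in Aint -> y \in Aint ->
    P (x * y) -> P x \/ P y }.

Lemma prime_above_exists (q : nat) : prime q -> exists P, prime_above q P.
Proof.
move=> q_pr.
pose proper (A : set algC) := [/\ forall x, A x -> x \in Aint,
  forall x y, A x -> A y -> A (x + y),
  forall a x, a \in Aint -> A x -> A (a * x), A q%:R & ~ A 1].
have q_neq0 : q%:R != 0 :> algC by rewrite pnatr_eq0 -lt0n prime_gt0.
(* The empty chain has union [set0], which is not an ideal; hence the extra disjunct. The maximal
   set is nonempty because the ideal generated by q is proper: 1/q is not integral. *)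
have [|A [PA maxA]] := @Zorn_bigcup algC (fun A => A = set0 \/ proper A).
  move=> F FP Ftot.
  have [[X FX [x Xx]]|noX] := pselect (exists2 X, F X & X !=set0); last first.
    left; apply/seteqP; split => // x [X FX Xx]; apply: noX.
    by exists X => //; exists x.
  have Fpr Y y : F Y -> Y y -> proper Y.
    by move=> FY Yy; case: (FP _ FY) => // Y0; move: Yy; rewrite Y0.
  right; split.
  - by move=> y [Y FY Yy]; have [+ _ _ _ _] := Fpr _ _ FY Yy; apply.
  - move=> y z [Y FY Yy] [Z FZ Zz].
    have [_ YD _ _ _] := Fpr _ _ FY Yy; have [_ ZD _ _ _] := Fpr _ _ FZ Zz.
    by case: (Ftot _ _ FY FZ) => sub; [exists Z | exists Y] => //;
      [apply: ZD => //; apply: sub | apply: YD => //; apply: sub].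
  - move=> a y aA [Y FY Yy]; exists Y => //.
    by have [_ _ + _ _] := Fpr _ _ FY Yy; apply.
  - by exists X => //; have [] := Fpr _ _ FX Xx.
  - by move=> [Y FY Y1]; have [_ _ _ _] := Fpr _ _ FY Y1; apply.
have ApropA : proper A.
  case: PA => // A0; exfalso.
  have Aq : q%:R \in Aint by rewrite Aint_Cnat.
  pose B := [set x | exists2 b : algC, b \in Aint & x = b * q%:R].
  apply: (maxA B).
    rewrite A0; split => //; move=> /(_ q%:R); apply.
    by exists 1; rewrite ?Aint1 ?mul1r.
  right; split.
  - by move=> _ [b bA ->]; rewrite rpredM.
  - by move=> _ _ [b bA ->] [c cA ->]; exists (b + c); rewrite ?rpredD ?mulrDl.
  - by move=> a _ aA [b bA ->]; exists (a * b); rewrite ?rpredM ?mulrA.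
  - by exists 1; rewrite ?Aint1 ?mul1r.
  - move=> [b bA b1].
    have Db : b = q%:R^-1 by apply: (mulIf q_neq0); rewrite -b1 mulVf.
    have : b \in Num.int.
      by apply: Cint_rat_Aint => //; rewrite Db rpredV rpred_nat.
    move=> /intrP[m Dm]; move: b1; rewrite Dm => /esym/eqP.
    rewrite -[q%:R]/((q%:Z)%:~R) -intrM -[1]/(1%:~R) eqr_int => /eqP mq1.
    have: (q %| absz (1 : int)%R)%N by rewrite -mq1 abszM dvdn_mull.
    by rewrite dvdn1 => /eqP q1; rewrite q1 in q_pr.
case: ApropA => A1 A2 A3 A4 A5; exists A; split => // x y xA yA Axy.
apply: contrapT => /not_orP[nAx nAy].
(* By maximality, [A] together with any integral z outside it generates the unit ideal. *)
have ext z : z \in Aint -> ~ A z -> exists2 b : algC, b \in Aint & A (1 - b * z).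
  move=> zA nAz; pose B := [set u | exists a b : algC, [/\ A a, b \in Aint & u = a + b * z]].
  have A0 : A 0 by rewrite -(mul0r q%:R); apply: A3 => //; exact: Aint0.
  have sAB : A `<` B.
    split; last by move=> /(_ z) BA; apply/nAz/BA; exists 0, 1; rewrite Aint1 add0r mul1r.
    by move=> u Au; exists u, 0; rewrite Aint0 mul0r addr0.
  have := maxA B sAB => /not_orP[_ nB].
  have [|nB1] := pselect (B 1).
    by move=> [a [b [Aa bA D1]]]; exists b => //; rewrite D1 addrK.
  case: nB; split => //.
  - by move=> _ [a [b [Aa bA ->]]]; apply: rpredD; [exact: A1 | exact: rpredM].
  - move=> _ _ [a [b [Aa bA ->]]] [c [d [Ac dA ->]]].
    by exists (a + c), (b + d); split; [exact: A2 | exact: rpredD | rewrite mulrDl addrACA].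
  - move=> e _ eA [a [b [Aa bA ->]]].
    by exists (e * a), (e * b); split; [exact: A3 | exact: rpredM | rewrite mulrDr mulrA].
  - by apply: sAB.1.
have [b bA Ab] := ext x xA nAx; have [c cA Ac] := ext y yA nAy.
apply: A5.
have -> : 1 = (1 - b * x) + (b * x) * (1 - c * y) + (b * c) * (x * y).
  by rewrite mulrBr mulr1 addrA subrK mulrACA subrK.
apply: (A2); last by apply: (A3) => //; exact: rpredM.
by apply: (A2) => //; apply: (A3) => //; exact: rpredM.
Qed.

Section Residues.
Variables (q : nat) (P : algC -> Prop).
Hypotheses (q_pr : prime q) (PP : prime_above q P).

Lemma prime_aboveMr a x : a \in Aint -> P x -> P (x * a).
Proof. by rewrite mulrC; apply: (prime_aboveMl PP). Qed.

Lemma prime_above0 : P 0.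
Proof.
by rewrite -(mul0r q%:R); apply: (prime_aboveMl PP) (Aint0) (prime_above_self PP).
Qed.

Lemma prime_aboveN x : P x -> P (- x).
Proof. by rewrite -mulN1r; apply: (prime_aboveMl PP); rewrite rpredN Aint1. Qed.

Lemma prime_aboveB x y : P x -> P y -> P (x - y).
Proof. by move=> Px Py; apply: (prime_aboveD PP) => //; apply: prime_aboveN. Qed.

Lemma prime_above_sum (I : Type) (r : seq I) (Q : pred I) (F : I -> algC) :
  (forall i, Q i -> P (F i)) -> P (\sum_(i <- r | Q i) F i).
Proof.
by move=> PF; apply: big_ind => //; [exact: prime_above0 | exact: (prime_aboveD PP)].
Qed.

(** By Bezout, an integer of P prime to q would put 1 in P. *)
Lemma prime_above_dvd (m : int) : P m%:~R <-> (q %| `|m|)%N.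
Proof.
split=> [Pm|]; last first.
  rewrite -[(q %| _)%N]/((q%:Z %| m)%Z) => /dvdzP[a ->]; rewrite intrM.
  by apply: (prime_aboveMl PP) (Aint_int _) (prime_above_self PP).
have [//|ndvd] := boolP (q %| `|m|)%N; case: (prime_above_proper PP).
have : coprimez q%:Z m by rewrite coprimezE prime_coprime.
move=> /coprimezP[[u v] /= uv]; rewrite -[1]/(1%:~R) -uv intrD !intrM.
apply: (prime_aboveD PP).
  by apply: (prime_aboveMl PP) (Aint_int _) (prime_above_self PP).
by apply: (prime_aboveMl PP) (Aint_int _) _.
Qed.

Lemma prime_above_exp x n : x \in Aint -> P (x ^+ n) -> P x.
Proof.
move=> xA; elim: n => [|n IHn]; first by rewrite expr0 => /(prime_above_proper PP).
by rewrite exprS => /(prime_above_prime PP xA (rpredX _ xA))[].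
Qed.

Definition polyIn (A : {poly algC}) := forall i, P A`_i.

Lemma polyIn_mul (A B : {poly algC}) : A \is a polyOver Aint ->
  B \is a polyOver Aint -> polyIn (A * B) -> polyIn A \/ polyIn B.
Proof.
move=> /polyOverP Aint_A /polyOverP Aint_B PAB.
apply: contrapT => /not_orP[/existsNP exA /existsNP exB].
have {}exA : exists i, `[< ~ P A`_i >] by case: exA => i ?; exists i; apply/asboolP.
have {}exB : exists i, `[< ~ P B`_i >] by case: exB => i ?; exists i; apply/asboolP.
case: (ex_minnP exA) => i /asboolP nAi minA.
case: (ex_minnP exB) => j /asboolP nBj minB.
have ltA l : (l < i)%N -> P A`_l.
  by apply: contraPP => nAl; rewrite ltnNge minA //; apply/asboolP.
have ltB l : (l < j)%N -> P B`_l.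
  by apply: contraPP => nBl; rewrite ltnNge minB //; apply/asboolP.
have [] := prime_above_prime PP (Aint_A i) (Aint_B j); [|by []|by []].
have lt_i : (i < (i + j).+1)%N by rewrite ltnS leq_addr.
have := PAB (i + j)%N; rewrite coefM (bigD1 (Ordinal lt_i)) //= addKn => Psum.
rewrite -(addrK (\sum_(l < (i + j).+1 | l != Ordinal lt_i) A`_l * B`_(i + j - l)) (_ * _)).
apply: prime_aboveB => //; apply: prime_above_sum => l.
rewrite -val_eqE /= neq_ltn => /orP[lt_li | lt_il].
  by apply: prime_aboveMr; last exact: ltA.
apply: (prime_aboveMl PP) => //; apply: ltB.
by rewrite ltn_subLR ?ltn_add2r // -ltnS.
Qed.

Lemma polyIn_mull (A B : {poly algC}) : A \is a polyOver Aint ->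
  polyIn B -> polyIn (A * B).
Proof.
move=> /polyOverP Aint_A PB i; rewrite coefM; apply: prime_above_sum => j _.
exact: (prime_aboveMl PP).
Qed.

Lemma polyIn_prod (I : eqType) (r : seq I) (F : I -> {poly algC}) :
  (forall i, i \in r -> F i \is a polyOver Aint) ->
  polyIn (\prod_(i <- r) F i) -> exists2 i, i \in r & polyIn (F i).
Proof.
elim: r => [_ | i r IHr Aint_F].
  by rewrite big_nil => /(_ 0); rewrite coef1 => /(prime_above_proper PP).
have Aint_r j : j \in r -> F j \is a polyOver Aint.
  by move=> rj; apply: Aint_F; rewrite inE rj orbT.
rewrite big_cons => /polyIn_mul[||PF|]; first by apply: Aint_F; rewrite mem_head.
- by rewrite big_seq; apply: rpred_prod => j rj; apply: Aint_r.
- by exists i => //; rewrite mem_head.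
- by move=> /(IHr Aint_r)[j rj PFj]; exists j => //; rewrite inE rj orbT.
Qed.

End Residues.

(** * Inertia elements and limits of automorphisms *)

Lemma Cint_fixed (x : algC) : x \in Aint ->
  (forall s : {rmorphism algC -> algC}, s x = x) -> exists m : int, x = m%:~R.
Proof. by move=> xA fix_x; apply/intrP/Cint_rat_Aint => //; apply: Crat_fixed. Qed.

(** The orbit is finite because an image of [Th] is determined by the positions in [rs] of the
    images of its coefficients. Since [Th] carries all the roots, one congruence between polynomials
    will control every root at once. *)
Lemma stab_orbit_seq (rs : seq algC) (d : algC) (Th := \poly_(i < size rs) rs`_i) :
  (forall (s : {rmorphism algC -> algC}) r, r \in rs -> s r \in rs) ->
  exists orb : seq {poly algC}, uniq orb /\ forall Q, Q \in orb <->
    exists2 s : {rmorphism algC -> algC}, s d = d & Q = map_poly s Th.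
Proof.
move=> rs_stable; pose N := size rs.
pose C := [seq \poly_(i < N) rs`_(nth N (map val (val w)) i) | w : N.-tuple 'I_N].
exists (undup [seq Q <- C | `[< exists2 s : {rmorphism algC -> algC},
   s d = d & Q = map_poly s Th >]]).
split=> [|Q]; first exact: undup_uniq.
rewrite mem_undup mem_filter; split=> [/andP[/asboolP] //|exQ].
apply/andP; split; first exact/asboolP.
have [s _ ->] := exQ; have ltN (i : 'I_N) : (index (s (nth 0%R rs i)) rs < N)%N.
  by rewrite index_mem rs_stable // mem_nth.
apply/mapP; exists [tuple Ordinal (ltN i) | i < N]; first by rewrite mem_enum.
apply/polyP => i; rewrite coef_map /= !coef_poly.
case: ltnP => [lt_i|]; last by rewrite rmorph0.
rewrite -map_comp (nth_map (Ordinal lt_i)) /= ?size_enum_ord //.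
by rewrite nth_index ?nth_enum_ord // rs_stable ?mem_nth.
Qed.

(** The left side has even valuation at q, so the valuation of e is odd, hence positive. *)
Lemma odd_logn_square_dvd (q : nat) (m e D : int) : prime q -> m != 0 ->
  m ^+ 2 = e * D -> odd (logn q `|D|) -> (q %| `|e|)%N.
Proof.
move=> q_pr m_neq0 eqm oddD; apply: contraLR oddD => ndvd.
have : (e * D) != 0 by rewrite -eqm expf_neq0.
rewrite mulf_eq0 negb_or => /andP[e0 D0].
have := congr1 (fun x : int => odd (logn q `|x|)) eqm.
rewrite abszX abszM lognX lognM ?absz_gt0 // oddM oddD /=.
by rewrite lognE (negPf ndvd) !andbF /= => <-.
Qed.

Lemma inertia_exists (q : nat) (P : algC -> Prop) (rs : seq algC) (d : algC) (D : int) :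
    prime q -> prime_above q P ->
    (forall r, r \in rs -> r \in Aint) ->
    (forall (s : {rmorphism algC -> algC}) r, r \in rs -> s r \in rs) ->
    d \in Aint -> d ^+ 2 = D%:~R -> odd (logn q `|D|) ->
  exists2 s : {rmorphism algC -> algC}, s d = - d &
    forall r, r \in rs -> P (r - s r).
Proof.
move=> q_pr PP rsA rs_stable dA d2 oddD.
have d_neq0 : d != 0.
  apply: contraTneq oddD => d0; move: d2; rewrite d0 expr0n /= => /esym/eqP.
  by rewrite intr_eq0 => /eqP ->; rewrite logn0.
have sgn (s : {rmorphism algC -> algC}) : s d = d \/ s d = - d.
  apply/pred2P; rewrite -eqf_sqr; apply/eqP.
  by rewrite -rmorphXn /= d2 rmorph_int.
(* Otherwise d would be a rational integer of square D, against the odd valuation of D. *)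
have [t td] : exists t : {rmorphism algC -> algC}, t d = - d.
  apply: contrapT => /forallNP no_t.
  have [s|m Dm] := Cint_fixed dA; first by case: (sgn s) => // /no_t.
  have m_neq0 : m != 0 by apply: contra_neq d_neq0 => m0; rewrite Dm m0.
  have /(odd_logn_square_dvd q_pr m_neq0)/(_ oddD) : m ^+ 2 = 1 * D.
    by apply/eqP; rewrite mul1r -(eqr_int algC) rmorphXn /= -Dm d2.
  by rewrite dvdn1 => /eqP q1; rewrite q1 in q_pr.
have t'd : algC_invaut t d = - d by apply: (canLR (algC_autK t)); rewrite rmorphN /= td opprK.
(* Let e be the square of t a - a and m its product with d. Every automorphism fixes both, so they
   are integers, and m^2 = e D makes q divide e. *)
have resid a : a \in Aint ->
    (forall s : {rmorphism algC -> algC}, s d = d -> s a = a) -> P (t a - a).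
  move=> aA fix_a.
  have fixP (s : {rmorphism algC -> algC}) : s d = d -> s a = a /\ s (t a) = t a.
    move=> sd; split; first exact: fix_a.
    have := fix_a (algC_invaut t \o s \o t)%FUN; rewrite /= td !rmorphN /= sd t'd opprK.
    by move=> /(_ erefl) /(canRL (algC_invautK t)).
  have fixN (s : {rmorphism algC -> algC}) : s d = - d -> s a = t a /\ s (t a) = a.
    move=> sd; split.
      have := fix_a (algC_invaut t \o s)%FUN; rewrite /= sd rmorphN /= t'd opprK.
      by move=> /(_ erefl) /(canRL (algC_invautK t)).
    have := fix_a (s \o t)%FUN; rewrite /= td rmorphN /= sd opprK.
    exact.
  have taA : t a \in Aint by rewrite Aint_aut.
  have [s|e De] := @Cint_fixed ((t a - a) ^+ 2) (rpredX _ (rpredB taA aA)).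
    rewrite rmorphXn rmorphB /=.
    by case: (sgn s) => [/fixP[-> ->]//|/fixN[-> ->]]; rewrite -sqrrN opprB.
  have [s|m Dm] := @Cint_fixed ((t a - a) * d) (rpredM (rpredB taA aA) dA).
    rewrite rmorphM rmorphB /=; case: (sgn s) => [sd|sd].
      by have [-> ->] := fixP _ sd; rewrite sd.
    by have [-> ->] := fixN _ sd; rewrite sd mulrN -mulNr opprB.
  have [m0|m_neq0] := eqVneq m 0.
    move/eqP: Dm; rewrite m0 mulf_eq0 (negPf d_neq0) orbF => /eqP ->.
    exact: prime_above0 PP.
  apply: (prime_above_exp PP (n := 2)); first exact: rpredB.
  rewrite De; apply/(prime_above_dvd q_pr PP).
  apply: (odd_logn_square_dvd q_pr m_neq0) oddD.
  by apply/eqP; rewrite -(eqr_int algC) rmorphXn rmorphM /= -Dm -De -d2 exprMn.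
pose Th : {poly algC} := \poly_(i < size rs) rs`_i.
have ThA : Th \is a polyOver Aint.
  by apply/polyOver_poly => i ?; rewrite rsA ?mem_nth.
have mapA (s : {rmorphism algC -> algC}) (Q : {poly algC}) :
    Q \is a polyOver Aint -> map_poly s Q \is a polyOver Aint.
  by move=> /polyOverP QA; apply/polyOverP => i; rewrite coef_map Aint_aut.
have [orb [orb_uniq orbP]] := stab_orbit_seq d rs_stable.
have orbA Q : Q \in orb -> Q \is a polyOver Aint.
  by move=> /orbP[s _ ->]; apply: mapA.
have Th_orb : Th \in orb.
  by apply/orbP; exists idfun => //; rewrite map_poly_id.
pose F : {poly {poly algC}} := \prod_(Q <- orb) ('X - Q%:P).
have mapF (s : {rmorphism algC -> algC}) :
    map_poly (map_poly s) F = \prod_(Q <- orb) ('X - (map_poly s Q)%:P).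
  by rewrite rmorph_prod /=; apply: eq_bigr => Q _; rewrite map_polyXsubC.
have fixF (s : {rmorphism algC -> algC}) : s d = d -> map_poly (map_poly s) F = F.
  move=> sd; rewrite mapF -(big_map (map_poly s) xpredT (fun Q => 'X - Q%:P)).
  apply: perm_big; apply: uniq_perm => //.
    by rewrite map_inj_uniq //; apply: map_poly_inj.
  have sub : {subset map (map_poly s) orb <= orb}.
    move=> _ /mapP[_ /orbP[s1 s1d ->] ->]; apply/orbP.
    exists (s \o s1)%FUN; first by rewrite /= s1d sd.
    by rewrite -map_poly_comp.
  by have [] := uniq_min_size _ sub; rewrite ?size_map // map_inj_uniq //; apply: map_poly_inj.
have FA j : F`_j \is a polyOver Aint.
  rewrite /F; elim: (orb) orbA j => [|Q l IHl] lA j.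
    by rewrite big_nil coef1 rpred_nat.
  have {}IHl := IHl (fun R lR => lA R (@mem_behead _ (Q :: l) R lR)).
  rewrite big_cons mulrBl coefB coefXM coefCM rpredB //.
    by case: ifP => _; rewrite ?rpred0.
  by rewrite rpredM // lA ?mem_head.
have PF : polyIn P (map_poly (map_poly t) F).[Th].
  (* Subtracting F(Th) = 0 leaves a combination of differences t a - a, where a runs over
     coefficients fixed by the stabiliser of d. *)
  have F0 : F.[Th] = 0.
    by apply/eqP; rewrite -/(root _ _) root_prod_XsubC.
  rewrite -(subr0 _.[Th]) -F0 !horner_coef size_map_inj_poly ?rmorph0 //; last exact: map_poly_inj.
  rewrite -sumrB => i; rewrite coef_sum; apply: (prime_above_sum PP) => j _.
  rewrite -mulrBl mulrC; apply: (polyIn_mull PP); first exact: rpredX.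
  move=> l; rewrite coefB !coef_map /=; apply: resid; first exact: (polyOverP (FA j)).
  by move=> s /fixF/polyP/(_ j); rewrite coef_map => /polyP/(_ l); rewrite coef_map.
move: PF; rewrite mapF horner_prod.
under eq_bigr do rewrite hornerXsubC.
move=> /(polyIn_prod PP)[|Q /orbP[s sd ->] PQ].
  by move=> Q Qorb; rewrite rpredB ?mapA ?orbA.
exists (t \o s)%FUN => [|r rsr]; first by rewrite /= sd td.
have := PQ (index r rs); rewrite coefB !coef_map coef_poly index_mem rsr.
by rewrite nth_index.
Qed.

(* Each orbit is finite, so the values along an ultrafilter stabilise. *)
Lemma aut_limit (s_ : nat -> {rmorphism algC -> algC}) :
  exists s : {rmorphism algC -> algC}, forall x y : algC,
    (exists N, forall m, (N <= m)%N -> s_ m x = y) -> s x = y.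
Proof.
have [U [UU leU]] := @ultraFilterLemma nat eventually _.
have lim x : exists y, U [set m | s_ m x = y].
  have [r Dr] := closed_field_poly_normal (minCpoly x).
  rewrite (monicP (minCpoly_monic x)) scale1r in Dr.
  have : U [set m | s_ m x \in r].
    apply: filterS filterT => m _ /=.
    by rewrite -root_prod_XsubC -Dr -(minCpoly_aut (s_ m)) root_minCpoly.
  elim: r {Dr} => [|y r IHr] Ur.
    by have [m] := filter_ex Ur; rewrite /= in_nil.
  have [Uy|Uy] := in_ultra_setVsetC [set m | s_ m x = y] UU; first by exists y.
  apply: IHr; apply: filterS (filterI Ur Uy) => m [/= + /eqP/negPf].
  by rewrite inE => /orP[->|].
have [s Ds] := choice lim.
have uniqU x y : U [set m | s_ m x = y] -> s x = y.
  by move=> Uxy; have [m [/= <- <-]] := filter_ex (filterI Uxy (Ds x)).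
have sB : zmod_morphism s.
  move=> x y; apply: uniqU; apply: filterS (filterI (Ds x) (Ds y)) => m [/= <- <-].
  exact: rmorphB.
have sM : monoid_morphism s.
  split=> [|x y]; apply: uniqU.
    by apply: filterS filterT => m _; apply: rmorph1.
  by apply: filterS (filterI (Ds x) (Ds y)) => m [/= <- <-]; apply: rmorphM.
pose sBM := GRing.isZmodMorphism.Build _ _ s sB.
pose sMM := GRing.isMonoidMorphism.Build _ _ s sM.
pose sR : {rmorphism algC -> algC} := HB.pack s sBM sMM.
exists sR => x y [N leN]; apply: uniqU; apply: leU; exists N => //.
Qed.

(** * Root lists of monic polynomials *)

Definition poly_roots (f : {poly algC}) : seq algC := sval (closed_field_poly_normal f).

Lemma poly_rootsE (f : {poly algC}) : f \is monic ->
  f = \prod_(z <- poly_roots f) ('X - z%:P).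
Proof.
move=> f_mon; have := svalP (closed_field_poly_normal f).
by rewrite -/(poly_roots f) (monicP f_mon) scale1r.
Qed.

Lemma deriv_prod_XsubC (rs : seq algC) (r : algC) : r \in rs ->
  (\prod_(z <- rs) ('X - z%:P))^`().[r] = \prod_(z <- rem r rs) (r - z).
Proof.
move=> rsr; rewrite (perm_big _ (perm_to_rem rsr)) big_cons /= derivM derivXsubC.
rewrite mul1r hornerD hornerM hornerXsubC subrr mul0r addr0 horner_prod.
by apply: eq_bigr => z _; rewrite hornerXsubC.
Qed.

(** A repeated root r leaves a factor r - r in the derivative at r, since [rem] deletes a single
    copy. *)
Lemma uniq_prod_XsubC (rs : seq algC) :
  {in rs, forall r, (\prod_(z <- rs) ('X - z%:P))^`().[r] != 0} -> uniq rs.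
Proof.
move=> der_neq0; apply: count_mem_uniq => r.
have [rsr|/count_memPn ->//] := boolP (r \in rs).
have := der_neq0 r rsr; rewrite deriv_prod_XsubC //.
have [rem_r|/count_memPn] := boolP (r \in rem r rs).
  by rewrite (perm_big _ (perm_to_rem rem_r)) big_cons /= subrr mul0r eqxx.
rewrite count_mem_rem eqxx /= => /eqP; rewrite subn_eq0 => le1 _.
by apply/eqP; rewrite eqn_leq le1 -has_count has_pred1.
Qed.

Lemma prod_aut_stable (s : {rmorphism algC -> algC}) (l : seq algC) : uniq l ->
  {in l, forall z, s z \in l} -> \prod_(z <- l) s z = \prod_(z <- l) z.
Proof.
move=> l_uniq l_stable; rewrite -(big_map s xpredT id); apply: perm_big.
have sl_uniq : uniq (map s l) by rewrite map_inj_uniq //; apply: fmorph_inj.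
have sub : {subset map s l <= l} by move=> _ /mapP[z lz ->]; apply: l_stable.
by apply: uniq_perm => //; have [] := uniq_min_size sl_uniq sub; rewrite ?size_map.
Qed.

(** * The polynomial, its fibers and the levels of the tree *)

(** Evaluation of [phi_pk] in an arbitrary ring, so that ring morphisms transport orbits, in
    particular from the integers to [algC]. *)
Definition Phi (p k : nat) (R : comNzRingType) (x : R) : R :=
  x ^+ p + (k * p)%:R * x ^+ p.-1 - (k * p)%:R.

Lemma rmorph_Phi p k (R S : comNzRingType) (f : {rmorphism R -> S}) (x : R) :
  f (Phi p k x) = Phi p k (f x).
Proof. by rewrite /Phi rmorphB rmorphD rmorphM /= !rmorphXn /= rmorph_nat. Qed.

Lemma rmorph_iter_Phi p k (R S : comNzRingType) (f : {rmorphism R -> S}) n (x : R) :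
  f (iter n (@Phi p k R) x) = iter n (@Phi p k S) (f x).
Proof. by elim: n => //= n <-; rewrite rmorph_Phi. Qed.

Section Dynamics.
Variables p k : nat.
Hypotheses (p_pr : prime p) (k_gt0 : (0 < k)%N) (p_ndvd_k : ~~ (p %| k)%N).

Local Notation phi := (phi_pk p k).
Local Notation F := (@Phi p k algC).
Local Notation FZ := (@Phi p k int).

Definition crit : int := - (k * p.-1)%:R.

Lemma prime_predK : p = p.-2.+2.
Proof. by case: p (prime_gt1 p_pr) => [|[|m]]. Qed.

Lemma qbar_phiE : qbar phi = 'X^p + (k * p)%:R%:P * 'X^(p.-1) - (k * p)%:R%:P.
Proof.
rewrite /qbar /phi_pk rmorphB rmorphD rmorphM /= !map_polyXn map_polyC /=.
by rewrite !rmorph_nat.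
Qed.

Lemma horner_qbar x : (qbar phi).[x] = F x.
Proof. by rewrite qbar_phiE !hornerE. Qed.

Lemma qbar_iterS n : qbar (iter_poly phi n.+1) = qbar phi \Po qbar (iter_poly phi n).
Proof. by rewrite /qbar -map_comp_poly. Qed.

Lemma qbar_iterSr n : qbar (iter_poly phi n.+1) = qbar (iter_poly phi n) \Po qbar phi.
Proof.
elim: n => [|n IHn].
  by rewrite qbar_iterS /qbar /iter_poly /= map_polyX comp_polyX comp_polyXr.
by rewrite qbar_iterS {1}IHn comp_polyA -qbar_iterS.
Qed.

Lemma horner_qbar_iter n x : (qbar (iter_poly phi n)).[x] = iter n F x.
Proof.
elim: n => [|n IHn]; first by rewrite /qbar map_polyX hornerX.
by rewrite qbar_iterS horner_comp IHn horner_qbar.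
Qed.

Lemma monic_fiber_poly (b : algC) :
  (qbar phi - b%:P \is monic) * (size (qbar phi - b%:P) = p.+1).
Proof.
suff: (qbar phi - b%:P)`_p = 1 /\ (size (qbar phi - b%:P)%R <= p.+1)%N.
  move=> [lc sz]; have szE : size (qbar phi - b%:P) = p.+1.
    apply/eqP; rewrite eqn_leq sz ltnNge; apply/negP => /leq_sizeP/(_ p (leqnn p)).
    by rewrite lc => /eqP; rewrite oner_eq0.
  by split => //; apply/monicP; rewrite /lead_coef szE.
have p_gt0 := prime_gt0 p_pr.
split.
  rewrite qbar_phiE !coefB coefD coefXn eqxx coefCM coefXn !coefC.
  by rewrite prime_predK /= !gtn_eqF // mulr0 !subr0 addr0.
apply/leq_sizeP => j lt_pj; rewrite qbar_phiE !coefB coefD coefXn coefCM coefXn !coefC.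
have lt_p1j := leq_ltn_trans (leq_pred p) lt_pj.
have lt_0j := leq_ltn_trans (leq0n p) lt_pj.
by rewrite !gtn_eqF // mulr0 addr0 !subr0.
Qed.

Definition fib (b : algC) : seq algC := poly_roots (qbar phi - b%:P).

Lemma fibE b : qbar phi - b%:P = \prod_(z <- fib b) ('X - z%:P).
Proof. by apply: poly_rootsE; rewrite monic_fiber_poly. Qed.

Lemma mem_fib b z : (z \in fib b) = (F z == b).
Proof.
by rewrite -root_prod_XsubC -fibE rootE hornerD hornerN hornerC horner_qbar subr_eq0.
Qed.

Lemma size_fib b : size (fib b) = p.
Proof. by apply: succn_inj; rewrite -(monic_fiber_poly b) fibE size_prod_XsubC. Qed.

Lemma deriv_fiber b x :
  (qbar phi - b%:P)^`().[x] = p%:R * x ^+ p.-2 * (x - crit%:~R).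
Proof.
rewrite qbar_phiE.
have deriv1 m : ('X^m : {poly algC})^`().[x] = m%:R * x ^+ m.-1.
  by rewrite derivXn hornerMn hornerXn mulr_natl.
rewrite !derivB derivD mul_polyC derivZ !derivC !subr0 hornerD hornerZ !deriv1.
have -> : crit%:~R = - (k%:R * p.-1%:R) :> algC.
  by rewrite /crit rmorphN rmorph_nat natrM.
rewrite natrM.
have -> : x ^+ p.-1 = x * x ^+ p.-2 by rewrite {1}prime_predK exprS.
by ring.
Qed.

(** Concatenating fibers yields the factorisation of the iterate with multiplicities, before the
    roots are known to be distinct. *)
Fixpoint lev n : seq algC :=
  if n is m.+1 then flatten [seq fib b | b <- lev m] else [:: 0].

Lemma mem_lev n x : (x \in lev n) = (iter n F x == 0).
Proof.
elim: n x => [|n IHn] x; first by rewrite inE.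
rewrite iterSr -IHn; apply/flatten_mapP/idP => [[b bn]|xn].
  by rewrite mem_fib => /eqP ->.
by exists (F x) => //; rewrite mem_fib.
Qed.

Lemma mem_levS n x : (x \in lev n.+1) = (F x \in lev n).
Proof. by rewrite !mem_lev iterSr. Qed.

Lemma lev_aut (s : {rmorphism algC -> algC}) n x : x \in lev n -> s x \in lev n.
Proof. by rewrite !mem_lev -(rmorph_iter_Phi _ _ s) => /eqP ->; rewrite rmorph0. Qed.

Lemma lev_polyE n : qbar (iter_poly phi n) = \prod_(z <- lev n) ('X - z%:P).
Proof.
elim: n => [|n IHn]; first by rewrite big_seq1 /qbar map_polyX subr0.
rewrite qbar_iterSr IHn rmorph_prod /= big_flatten big_map; apply: eq_bigr => b _.
by rewrite -fibE comp_polyB comp_polyX comp_polyC.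
Qed.

Lemma prod_lev n x : \prod_(z <- lev n) (x - z) = iter n F x.
Proof.
rewrite -horner_qbar_iter lev_polyE horner_prod.
by apply: eq_bigr => z _; rewrite hornerXsubC.
Qed.

Lemma lev_Aint n x : x \in lev n -> x \in Aint.
Proof.
rewrite -root_prod_XsubC -lev_polyE => root_x; apply: root_monic_Aint root_x _ _.
  by rewrite lev_polyE monic_prod_XsubC.
by apply/polyOverP => i; rewrite coef_map intr_int.
Qed.

Lemma iter_Phi0 (R : comNzRingType) n : iter n.+1 (@Phi p k R) 0 = - (k * p)%:R.
Proof.
elim: n => [|n IHn].
  rewrite /= /Phi.
  have -> : 0 ^+ p = 0 :> R by rewrite prime_predK expr0n.
  have -> : 0 ^+ p.-1 = 0 :> R by rewrite prime_predK expr0n.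
  by rewrite mulr0 addr0 sub0r.
rewrite iterS IHn /Phi.
set x := - _; have -> : x ^+ p = x * x ^+ p.-1 by rewrite -exprS prednK ?prime_gt0.
by rewrite mulNr addNr sub0r.
Qed.

Lemma iter_critE n : (iter n FZ crit)%:~R = iter n F crit%:~R.
Proof. exact: rmorph_iter_Phi. Qed.

Hypothesis iter_crit_neq0 : forall n, iter n.+1 FZ crit != 0.

(** A double point of a fiber would be 0 or [crit], and neither is sent to 0 by a positive
    iterate. *)
Lemma fib_uniq n b : b \in lev n -> uniq (fib b).
Proof.
move=> bn; apply: uniq_prod_XsubC => r; rewrite mem_fib -fibE deriv_fiber => /eqP Fr.
have iter_r : iter n.+1 F r = 0 by apply/eqP; rewrite -mem_lev mem_levS Fr.
rewrite !mulf_neq0 ?pnatr_eq0 -?lt0n ?prime_gt0 //.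
- rewrite expf_neq0 //; apply/eqP => r0; move: iter_r; rewrite r0 iter_Phi0.
  by move/eqP; rewrite oppr_eq0 pnatr_eq0 muln_eq0 -!leqn0 leqNgt k_gt0 leqNgt prime_gt0.
- rewrite subr_eq0; apply/eqP => rc; move/eqP: iter_r.
  by rewrite rc -iter_critE intr_eq0 (negPf (iter_crit_neq0 _)).
Qed.

Lemma lev_uniq n : uniq (lev n).
Proof.
elim: n => //= n IHn.
have: {in lev n, forall b, uniq (fib b)} by move=> b; apply: fib_uniq.
elim: (lev n) IHn => //= b l IHl /andP[nlb l_uniq] l_fib.
rewrite cat_uniq l_fib ?mem_head // IHl //; last first.
  by move=> z lz; apply: l_fib; rewrite inE lz orbT.
rewrite andbT; apply/hasPn => z /flatten_mapP[b' lb'].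
rewrite mem_fib => /eqP Fz; rewrite /= mem_fib Fz.
by apply: contraNneq nlb => <-.
Qed.

Lemma separable_iter n : separable_poly (qbar (iter_poly phi n)).
Proof. by rewrite lev_polyE separable_prod_XsubC lev_uniq. Qed.

(** * Discriminants of the fibers *)

(** Both sides are the derivative at r of the polynomial whose roots form the fiber of r. *)
Lemma prod_fiber_neq n r : r \in lev n.+1 ->
  p%:R * r ^+ p.-2 * (r - crit%:~R)
    = \prod_(z <- lev n.+1 | (z != r) && (F z == F r)) (r - z).
Proof.
move=> rn; rewrite -(deriv_fiber (F r)) fibE deriv_prod_XsubC ?mem_fib //.
rewrite -[RHS]big_filter; apply: perm_big.
have Un : uniq (fib (F r)) by apply: (@fib_uniq n); rewrite -mem_levS.
apply: uniq_perm; rewrite ?rem_uniq ?filter_uniq ?lev_uniq // => z.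
rewrite mem_rem_uniq // mem_filter inE mem_fib.
have [->|] := eqVneq z r; first by [].
rewrite /=.
have [Fz|] := eqVneq (F z) (F r); last by [].
by rewrite mem_levS Fz -mem_levS rn.
Qed.

(** A square root, up to sign, of the product of the discriminants of the fibers making up the
    level. Pairs from different fibers are left out: they only contribute a power of the
    discriminant of the level below. *)
Definition delta n : algC :=
  \prod_(i < size (lev n)) \prod_(j < size (lev n) |
     (i < j)%N && (F (lev n)`_i == F (lev n)`_j)) ((lev n)`_i - (lev n)`_j).

Lemma delta_sqr n : exists e : nat,
  (delta n.+1) ^+ 2 = (-1) ^+ e * \prod_(r <- lev n.+1) (p%:R * r ^+ p.-2 * (r - crit%:~R)).
Proof.
set l := lev n.+1; set N := size l.
(* Reversing each pair turns the product over j < i into the product over i < j, up to sign. *)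
have [e De] : exists e : nat, \prod_(i < N) \prod_(j < N | (j < i)%N && (F l`_i == F l`_j))
   (l`_i - l`_j) = (-1) ^+ e * delta n.+1.
  exists (\sum_(j < N) \sum_(i < N | (j < i)%N && (F l`_j == F l`_i)) 1)%N.
  rewrite (exchange_big_dep xpredT) //= -prodrXr -big_split; apply: eq_bigr => j _ /=.
  under eq_bigl do rewrite eq_sym.
  rewrite -prodrXr -big_split; apply: eq_bigr => i _ /=.
  by rewrite expr1 mulN1r opprB.
exists e.
have -> : \prod_(r <- l) (p%:R * r ^+ p.-2 * (r - crit%:~R)) =
   \prod_(r <- l) \prod_(z <- l | (z != r) && (F z == F r)) (r - z).
  by rewrite big_seq [RHS]big_seq; apply: eq_bigr => r /prod_fiber_neq.
rewrite (big_nth 0) big_mkord -/N.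
have -> : \prod_(i < N) \prod_(z <- l | (z != l`_i) && (F z == F l`_i)) (l`_i - z)
   = \prod_(i < N) ((\prod_(j < N | (j < i)%N && (F l`_i == F l`_j)) (l`_i - l`_j))
   * \prod_(j < N | (i < j)%N && (F l`_i == F l`_j)) (l`_i - l`_j)).
  apply: eq_bigr => i _; rewrite (big_nth 0) big_mkord -/N.
  rewrite (bigID (fun j : 'I_N => (j < i)%N)) /=.
  congr (_ * _); apply: eq_bigl => j; rewrite nth_uniq ?lev_uniq //.
    by rewrite [F l`_j == _]eq_sym; case: (ltngtP j i) => //=; rewrite ?andbT ?andbF.
  by rewrite [F l`_j == _]eq_sym; case: (ltngtP j i) => //=; rewrite ?andbT ?andbF.
rewrite big_split /= De mulrA mulrA -expr2 -exprM mulnC exprM sqrrN expr1n expr1n mul1r.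
by rewrite expr2.
Qed.

Lemma delta_Aint n : delta n \in Aint.
Proof.
by apply: rpred_prod => i _; apply: rpred_prod => j _;
  apply: rpredB; apply: (@lev_Aint n); rewrite mem_nth.
Qed.

Lemma delta_fixed n (s : {rmorphism algC -> algC}) :
  {in lev n, s =1 id} -> s (delta n) = delta n.
Proof.
move=> fix_s; rewrite rmorph_prod; apply: eq_bigr => i _; rewrite rmorph_prod.
by apply: eq_bigr => j _; rewrite rmorphB /= !fix_s ?mem_nth.
Qed.

(** Over the whole level, the product of the roots r is, up to sign, the iterate at 0, namely -kp,
    and the product of the r - [crit] is the iterate at [crit]. Only the latter matters at a prime
    not dividing kp. *)
Lemma delta_sqr_int n (q : nat) : prime q -> ~~ (q %| k * p)%N -> exists2 D : int,
  (delta n.+1) ^+ 2 = D%:~R & logn q `|D| = logn q `|iter n.+1 FZ crit|.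
Proof.
move=> q_pr q_ndvd; have [e ->] := delta_sqr n; pose N := size (lev n.+1).
exists ((-1) ^+ e * (p%:R ^+ N * ((-1) ^+ N * - (k * p)%:R) ^+ p.-2 *
   ((-1) ^+ N * iter n.+1 FZ crit))).
  have prodN x : \prod_(z <- lev n.+1) (z - x) = (-1) ^+ N * iter n.+1 F x.
    rewrite -prod_lev /N -sum1_size -prodrXr -big_split /=.
    by apply: eq_bigr => z _; rewrite expr1 mulN1r opprB.
  have prod0 : \prod_(z <- lev n.+1) z = (-1) ^+ N * - (k * p)%:R.
    rewrite -(iter_Phi0 _ n) -prodN.
    by apply: eq_bigr => z _; rewrite subr0.
  rewrite !big_split /= prodN -iter_critE prodrXl prod0 big_const_seq count_predT.
  rewrite iter_mulr_1 -/N.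
  by rewrite !(rmorphM, rmorphXn, rmorphN, rmorph1, rmorph_nat).
have co m : ~~ (q %| m)%N -> logn q m = 0%N by move=> nd; rewrite lognE (negPf nd) !andbF.
have q_ndvd_p : ~~ (q %| p)%N by apply: contra q_ndvd => qp; rewrite dvdn_mull.
have kp_gt0 : (0 < k * p)%N by rewrite muln_gt0 k_gt0 prime_gt0.
rewrite !natz !(abszM, abszX, abszN) !absz_nat !exp1n !mul1n.
have C_gt0 : (0 < `|iter n.+1 FZ crit|)%N by rewrite absz_gt0 iter_crit_neq0.
have A_gt0 : (0 < p ^ N)%N by rewrite expn_gt0 prime_gt0.
have B_gt0 : (0 < (k * p) ^ p.-2)%N by rewrite expn_gt0 kp_gt0.
rewrite lognM ?muln_gt0 ?A_gt0 ?B_gt0 // lognM //.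
by rewrite !lognX (co p q_ndvd_p) (co _ q_ndvd) !muln0.
Qed.

Arguments lev : simpl never.

(** * Congruences between roots modulo a prime above q *)

Lemma crit_Aint : crit%:~R \in Aint. Proof. exact: Aint_int. Qed.

Lemma Phi_Aint x : x \in Aint -> F x \in Aint.
Proof. by move=> xA; rewrite !(rpredB, rpredD, rpredM, rpredX) ?rpred_nat. Qed.

Lemma Phi_cong q P : prime_above q P -> forall x y, x \in Aint -> y \in Aint ->
  P (x - y) -> P (F x - F y).
Proof.
move=> PP x y xA yA Pxy.
have expP m : P (x ^+ m - y ^+ m).
  rewrite subrXX; apply: (prime_aboveMr PP) => //.
  by apply: rpred_sum => i _; rewrite rpredM ?rpredX.
have -> : F x - F y = (x ^+ p - y ^+ p) + (k * p)%:R * (x ^+ p.-1 - y ^+ p.-1).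
  by rewrite /Phi; ring.
by apply: (prime_aboveD PP) => //; apply: (prime_aboveMl PP); rewrite ?rpred_nat.
Qed.

Lemma iter_Phi_cong q P n : prime_above q P -> forall x y, x \in Aint -> y \in Aint ->
  P (x - y) -> P (iter n F x - iter n F y).
Proof.
move=> PP; elim: n => // n IHn x y xA yA Pxy; rewrite !iterSr.
by apply: IHn; rewrite ?Phi_Aint //; apply: (Phi_cong PP).
Qed.

Lemma prod_sub_Aint (l : seq algC) (Q : pred algC) m r : r \in lev m ->
  {subset l <= lev m} -> \prod_(z <- l | Q z) (r - z) \in Aint.
Proof.
move=> rm lm; rewrite big_seq_cond; apply: rpred_prod => z /andP[lz _].
by apply: rpredB; apply: (@lev_Aint m) => //; apply: lm.
Qed.

Section Reduction.
Variables (q : nat) (P : algC -> Prop) (n : nat).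
Hypotheses (q_pr : prime q) (PP : prime_above q P) (q_ndvd : ~~ (q %| k * p)%N).
Hypothesis q_primitive : forall j, (0 < j < n)%N -> ~~ (q %| `|iter j FZ crit|)%N.

Lemma prime_not_in_P : ~ P p%:R.
Proof.
rewrite -[p%:R]/((p%:Z)%:~R) => /(prime_above_dvd q_pr PP) /= qp.
by move: q_ndvd; rewrite dvdn_mull.
Qed.

(** The iterate of order m + 1 sends r to 0 and 0 to -kp, so r in P would make q divide kp. *)
Lemma lev_not_in_P m r : r \in lev m.+1 -> ~ P r.
Proof.
move=> rm Pr; have rA := lev_Aint rm.
have := @iter_Phi_cong q P m.+1 PP r 0 rA Aint0; rewrite subr0 => /(_ Pr).
move: rm; rewrite mem_lev => /eqP ->; rewrite iter_Phi0 sub0r opprK.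
rewrite -[(k * p)%:R]/(((k * p)%:Z)%:~R) => /(prime_above_dvd q_pr PP) /=.
exact/negP.
Qed.

Lemma lev_crit_dvd m r : r \in lev m -> P (r - crit%:~R) -> (q %| `|iter m FZ crit|)%N.
Proof.
move=> rm Prc; apply/(prime_above_dvd q_pr PP); rewrite iter_critE.
have := @iter_Phi_cong q P m PP _ _ (lev_Aint rm) crit_Aint Prc.
move: rm; rewrite mem_lev => /eqP ->; rewrite sub0r => /(prime_aboveN PP).
by rewrite opprK.
Qed.

(** If the images of r and r' differed, induction would make F r congruent to [crit], and q would
    divide an earlier term of the critical orbit. So r and r' share a fiber, and r - r' divides the
    derivative at r, whose only factor that can lie in P is r - [crit]. *)
Lemma lev_cong m r r' : (m <= n)%N -> r \in lev m -> r' \in lev m -> r != r' ->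
  P (r - r') -> F r = F r' /\ P (r - crit%:~R).
Proof.
elim: m r r' => [|m IHm] r r' le_mn rm r'm rr' Prr'.
  by move: rm r'm rr'; rewrite !inE => /eqP -> /eqP ->; rewrite eqxx.
have rA := lev_Aint rm; have r'A := lev_Aint r'm.
have FF : F r = F r'.
  apply: contrapT => /eqP neqF.
  have Fr : F r \in lev m by rewrite -mem_levS.
  have Fr' : F r' \in lev m by rewrite -mem_levS.
  have [_ Pc] := IHm _ _ (ltnW le_mn) Fr Fr' neqF (Phi_cong PP rA r'A Prr').
  have m_gt0 : (0 < m)%N.
    rewrite lt0n; apply: contraNneq neqF => m0.
    by move: rm r'm; rewrite !mem_levS m0 !inE => /eqP -> /eqP ->.
  have := q_primitive (j := m); rewrite m_gt0 le_mn (@lev_crit_dvd _ (F r)) //.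
  by move=> /(_ isT).
split => //.
have : P (p%:R * r ^+ p.-2 * (r - crit%:~R)).
  rewrite (prod_fiber_neq rm) (big_rem r') //= eq_sym rr' FF eqxx /=.
  by apply: (prime_aboveMr PP) => //; apply: prod_sub_Aint rm _ => z /mem_rem.
have cA := crit_Aint.
move=> /(prime_above_prime PP)[||/(prime_above_prime PP)[|||]|//].
- by rewrite rpredM ?rpredX ?rpred_nat.
- exact: rpredB.
- by rewrite rpred_nat.
- exact: rpredX.
- by move/prime_not_in_P.
- by move/(prime_above_exp PP rA)/(lev_not_in_P rm).
Qed.

(* Writing phi'(r) = u_r (r - crit), a third congruent root makes
   phi'(r1) and phi'(r2) multiples of r1 - r2 by elements of P; eliminating crit
   and cancelling r1 - r2 puts u_r1 u_r2 into P. *)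
Lemma lev_cong3 m r1 r2 r3 : (m.+1 <= n)%N ->
  r1 \in lev m.+1 -> r2 \in lev m.+1 -> r3 \in lev m.+1 ->
  r1 != r2 -> r1 != r3 -> r2 != r3 -> P (r1 - r2) -> P (r1 - r3) -> False.
Proof.
move=> le_mn m1 m2 m3 n12 n13 n23 P12 P13.
have [F12 _] := lev_cong le_mn m1 m2 n12 P12.
have [F13 _] := lev_cong le_mn m1 m3 n13 P13.
have P23 : P (r2 - r3).
  have -> : r2 - r3 = (r1 - r3) - (r1 - r2) by ring.
  exact: (prime_aboveB PP).
have aux a b c : a \in lev m.+1 -> b \in lev m.+1 -> c \in lev m.+1 ->
   a != b -> a != c -> b != c -> F a = F b -> F a = F c -> P (a - c) ->
   exists2 u, P u & p%:R * a ^+ p.-2 * (a - crit%:~R) = (a - b) * u.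
  move=> am bm cm ab ac bc Fab Fac Pac; rewrite (prod_fiber_neq am).
  rewrite (big_rem b) //= eq_sym ab Fab eqxx /=; eexists; last by [].
  rewrite (big_rem c) /=; last by rewrite (rem_filter _ (lev_uniq _)) mem_filter /= eq_sym bc cm.
  rewrite eq_sym ac -Fab -Fac eqxx /=.
  by apply: (prime_aboveMr PP) => //; apply: prod_sub_Aint am _ => z /mem_rem/mem_rem.
have [u Pu Du] := aux r1 r2 r3 m1 m2 m3 n12 n13 n23 F12 F13 P13.
have [||v Pv Dv] := aux r2 r1 r3 m2 m1 m3 _ n23 n13 (esym F12) _ P23.
- by rewrite eq_sym.
- by rewrite -F12.
have A1 := lev_Aint m1; have A2 := lev_Aint m2.
pose U r : algC := p%:R * r ^+ p.-2.
have UA r : r \in Aint -> U r \in Aint by move=> rA; rewrite rpredM ?rpredX ?rpred_nat.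
have nU r : r \in lev m.+1 -> ~ P (U r).
  move=> rm /(prime_above_prime PP)[|||]; first by rewrite rpred_nat.
  - by rewrite rpredX ?(lev_Aint rm).
  - exact: prime_not_in_P.
  - by move/(prime_above_exp PP (lev_Aint rm))/(lev_not_in_P rm).
have eqU : U r1 * U r2 = U r2 * u + U r1 * v.
  have r12 : r1 - r2 != 0 by rewrite subr_eq0.
  apply: (mulfI r12).
  have -> : (r1 - r2) * (U r1 * U r2) =
    U r2 * (U r1 * (r1 - crit%:~R)) - U r1 * (U r2 * (r2 - crit%:~R)) by ring.
  by rewrite /U Du Dv; ring.
have : P (U r1 * U r2).
  by rewrite eqU; apply: (prime_aboveD PP); apply: (prime_aboveMl PP); rewrite ?UA.
by move=> /(prime_above_prime PP (UA _ A1) (UA _ A2))[/(nU _ m1)|/(nU _ m2)].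
Qed.

End Reduction.

(** * Transpositions and transitivity of the Galois action on a level *)

Definition swap (a b x : algC) := if x == a then b else if x == b then a else x.

Lemma lev_transposition n : (exists q : nat, [/\ prime q, ~~ (q %| k * p)%N &
    odd (logn q `|iter n.+1 FZ crit|)]) ->
  exists (a b : algC) (s : {rmorphism algC -> algC}),
    [/\ a \in lev n.+1, b \in lev n.+1, a != b, F a = F b &
        {in lev n.+1, s =1 swap a b}].
Proof.
move=> [q [q_pr q_ndvd q_odd]]; have [P PP] := prime_above_exists q_pr.
have q_dvd : (q %| `|iter n.+1 FZ crit|)%N.
  by apply: contraTT q_odd => nd; rewrite lognE (negPf nd) !andbF.
(* If q divided an earlier term, the orbit would continue modulo q as that of 0, hence reach -kp,
   and q would divide kp. *)
have q_primitive j : (0 < j < n.+1)%N -> ~~ (q %| `|iter j FZ crit|)%N.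
  move=> /andP[j_gt0 lt_jn]; apply: contra q_ndvd => /(prime_above_dvd q_pr PP) Pj.
  apply/(prime_above_dvd q_pr PP (k * p)%:Z).
  have Dn : n.+1 = ((n - j).+1 + j)%N by lia.
  have jA : (iter j FZ crit)%:~R \in Aint by apply: Aint_int.
  have := @iter_Phi_cong q P (n - j).+1 PP _ _ jA Aint0; rewrite subr0 => /(_ Pj).
  rewrite iter_critE -iterD -Dn -iter_critE iter_Phi0 opprK => Psum.
  rewrite -[_%:~R](addKr (iter n.+1 FZ crit)%:~R) addrC; apply: (prime_aboveB PP) => //.
  exact/(prime_above_dvd q_pr PP).
have [D D2 logD] := delta_sqr_int n q_pr q_ndvd.
have [|||||s sd Ps] := @inertia_exists q P (lev n.+1) (delta n.+1) D q_pr PP.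
- exact: lev_Aint.
- by move=> s r; apply: lev_aut.
- exact: delta_Aint.
- exact: D2.
- by rewrite logD.
have d_neq0 : delta n.+1 != 0.
  apply: contraTneq q_odd => d0; rewrite -logD; move: D2; rewrite d0 expr0n /= => /esym/eqP.
  by rewrite intr_eq0 => /eqP ->; rewrite logn0.
(* An automorphism negating the nonzero [delta] must move some root. *)
have [a an sa] : exists2 a, a \in lev n.+1 & s a != a.
  apply: contrapT => nex; case/negP: d_neq0; rewrite -eqNr -sd; apply/eqP.
  apply: delta_fixed => r rn.
  by apply/eqP; apply: contrapT => /negP sr; apply: nex; exists r.
have stab r : r \in lev n.+1 -> s r \in lev n.+1 by apply: lev_aut.
have cong3 := @lev_cong3 q P n.+1 q_pr PP q_ndvd q_primitive n.
exists a, (s a), s; split=> //; first exact: stab.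
- by rewrite eq_sym.
- have := @lev_cong q P n.+1 q_pr PP q_ndvd q_primitive n.+1 a (s a) (leqnn _) an (stab _ an).
  by rewrite eq_sym => /(_ sa (Ps _ an))[].
move=> r rn; rewrite /swap; case: eqP => [-> //|/eqP ra].
have inj := fmorph_inj s.
(* Every moved root is congruent to [crit], hence to a. Since three distinct roots are never
   congruent, a and s a are the only moved roots. *)
have same x : x \in lev n.+1 -> s x != x -> P (a - x).
  move=> xn sx.
  have sym : x != s x by rewrite eq_sym.
  have syma : a != s a by rewrite eq_sym.
  have [_ Px] := @lev_cong q P n.+1 q_pr PP q_ndvd q_primitive n.+1 x (s x) (leqnn _) xn (stab _ xn) sym (Ps _ xn).
  have [_ Pa] := @lev_cong q P n.+1 q_pr PP q_ndvd q_primitive n.+1 a (s a) (leqnn _) an (stab _ an) syma (Ps _ an).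
  have -> : a - x = (a - crit%:~R) - (x - crit%:~R) by ring.
  exact: (prime_aboveB PP).
have sna : a != s a by rewrite eq_sym.
case: eqP => [r_sa|/eqP r_sa].
  apply/eqP; apply: contrapT => /negP ssa.
  have srr : s r != r by rewrite {2}r_sa (inj_eq inj).
  have s2 : s r \in lev n.+1 by apply: stab.
  apply: (cong3 a r (s r)) => //; [by rewrite eq_sym| by rewrite eq_sym | by rewrite eq_sym | exact: same |].
  by apply: same => //; rewrite (inj_eq inj).
apply/eqP; apply: contrapT => /negP sr.
apply: (cong3 a (s a) r) => //; rewrite ?stab //; [by rewrite eq_sym | by rewrite eq_sym | exact: Ps | exact: same].
Qed.

(** Eisenstein's argument on orbits. Modulo p the map is x^p, so all roots lie in P. If b were
    outside the orbit of a, the products of the roots inside and outside this orbit would be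
    integers divisible by p, with product kp up to sign, although p does not divide k. *)
Lemma lev_transitive n a b : a \in lev n -> b \in lev n ->
  exists s : {rmorphism algC -> algC}, s a = b.
Proof.
case: n => [|n] an bn.
  by exists idfun; move: an bn; rewrite !inE => /eqP -> /eqP ->.
have [P PP] := prime_above_exists p_pr.
have inP m x : x \in lev m -> P x.
  elim: m x => [|m IHm] x; first by rewrite inE => /eqP ->; apply: prime_above0 PP.
  move=> xm; have xA := lev_Aint xm; apply: (prime_above_exp PP (n := p)) => //.
  have PF : P (F x) by apply: IHm; rewrite -mem_levS.
  have -> : x ^+ p = F x - k%:R * p%:R * (x ^+ p.-1 - 1) by rewrite /Phi natrM; ring.
  apply: (prime_aboveB PP) => //; apply: (prime_aboveMr PP).
    by rewrite rpredB ?rpredX ?rpred1.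
  by apply: (prime_aboveMl PP); rewrite ?rpred_nat //; apply: prime_above_self PP.
apply: contrapT => no_s.
pose O z := `[< exists s : {rmorphism algC -> algC}, s a = z >].
have prodP (Q : pred algC) : (exists2 z, z \in lev n.+1 & Q z) ->
    (forall (s : {rmorphism algC -> algC}) z, Q z -> Q (s z)) ->
    exists2 m : int, \prod_(z <- [seq z <- lev n.+1 | Q z]) z = m%:~R & (p %| `|m|)%N.
  move=> [z0 z0n Qz0] Qs; set l := [seq z <- _ | _].
  have lA z : z \in l -> z \in Aint.
    by rewrite mem_filter => /andP[_]; apply: lev_Aint.
  have [||m Dm] := @Cint_fixed (\prod_(z <- l) z).
  - by rewrite big_seq; apply: rpred_prod.
  - move=> s; rewrite rmorph_prod prod_aut_stable ?filter_uniq ?lev_uniq // => z.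
    by rewrite !mem_filter => /andP[Qz zn]; rewrite Qs // lev_aut.
  exists m => //; apply/(prime_above_dvd p_pr PP); rewrite -Dm.
  have z0l : z0 \in l by rewrite mem_filter Qz0.
  rewrite (perm_big _ (perm_to_rem z0l)) big_cons /=; apply: (prime_aboveMr PP).
    by rewrite big_seq; apply: rpred_prod => z /mem_rem; apply: lA.
  exact: inP z0n.
have [||m1 D1 pm1] := prodP O.
- by exists a => //; apply/asboolP; exists idfun.
- by move=> s z /asboolP[s1 <-]; apply/asboolP; exists (s \o s1)%FUN.
have [||m2 D2 pm2] := prodP (fun z => ~~ O z).
- by exists b => //; apply/negP => /asboolP.
- move=> s z; apply: contra => /asboolP[s1 Ds1]; apply/asboolP.
  by exists (algC_invaut s \o s1)%FUN; rewrite /= Ds1 algC_autK.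
have : (m1 * m2)%:~R = (-1) ^+ (size (lev n.+1)).+1 * (k * p)%:R :> algC.
  have -> : (m1 * m2)%:~R = \prod_(z <- lev n.+1) z.
    by rewrite intrM -D1 -D2 !big_filter [RHS](bigID O).
  rewrite exprSr -mulrA mulN1r -(iter_Phi0 _ n).
  rewrite -prod_lev -sum1_size -prodrXr -big_split /=.
  by apply: eq_bigr => z _; rewrite expr1 mulN1r sub0r opprK.
(* Squaring removes the unknown sign. *)
move/(congr1 (fun x : algC => x ^+ 2)); rewrite exprMn -exprM mulnC exprM sqrrN !expr1n mul1r.
rewrite -natrX -rmorphXn /= -[(_ ^ 2)%:R]/(((k * p) ^ 2)%N%:Z%:~R) => /eqP.
rewrite eqr_int => /eqP/(congr1 absz); rewrite abszX abszM /= => /eqP; rewrite eqn_exp2r //.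
move/eqP => eqkp; have : (p * p %| k * p)%N by rewrite -eqkp dvdn_mul.
by rewrite dvdn_pmul2r ?prime_gt0 // (negPf p_ndvd_k).
Qed.

(** * Realizing the permutations that preserve fibers *)

Lemma swapC a b : swap a b =1 swap b a.
Proof. by move=> x; rewrite /swap; case: eqP => [->|]; case: eqP => // ->. Qed.

Lemma swapL a b : swap a b a = b. Proof. by rewrite /swap eqxx. Qed.

Lemma swapR a b : swap a b b = a.
Proof. by rewrite /swap eqxx; case: eqP. Qed.

Lemma swapD a b x : x != a -> x != b -> swap a b x = x.
Proof. by rewrite /swap => /negPf -> /negPf ->. Qed.

Lemma swap_inj (f : algC -> algC) a b x : injective f ->
  f (swap a b x) = swap (f a) (f b) (f x).
Proof. by move=> f_inj; rewrite /swap !(inj_eq f_inj); case: ifP => // _; case: ifP. Qed.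

Section Level.
Variable n : nat.

Definition linked a b := F a = F b /\
  exists s : {rmorphism algC -> algC}, {in lev n.+1, s =1 swap a b}.

Lemma linked_refl a : linked a a.
Proof.
split=> //; exists idfun => x _; rewrite /swap /=.
by case: (eqVneq x a).
Qed.

Lemma linked_sym a b : linked a b -> linked b a.
Proof. by move=> [Fab [s Ds]]; split=> //; exists s => x xn; rewrite swapC Ds. Qed.

Lemma linked_aut (t : {rmorphism algC -> algC}) a b : linked a b -> linked (t a) (t b).
Proof.
move=> [Fab [s Ds]]; split; first by rewrite -!rmorph_Phi Fab.
exists (t \o s \o algC_invaut t)%FUN => x xn /=.
rewrite Ds ?swap_inj ?algC_invautK //; first exact: fmorph_inj.
exact: (lev_aut (algC_invaut t)).
Qed.

(* Conjugating the transposition (a b) by an automorphism inducing (b c) gives (a c). *)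
Lemma linked_trans a b c : a \in lev n.+1 -> b \in lev n.+1 -> c \in lev n.+1 ->
  linked a b -> linked b c -> linked a c.
Proof.
move=> an bn cn ab bc; have [->|ac] := eqVneq a c; first exact: linked_refl.
have [ab_eq|nab] := eqVneq a b; first by rewrite ab_eq.
have [_ [t Dt]] := bc; have := linked_aut t ab.
by rewrite !Dt // swapL swapD.
Qed.

Definition link_class a := [seq z <- lev n.+1 | `[< linked a z >]].

(** The Galois action is transitive on the level and carries classes to classes. *)
Lemma size_link_class a b : a \in lev n.+1 -> b \in lev n.+1 ->
  size (link_class a) = size (link_class b).
Proof.
suff le_size x y : x \in lev n.+1 -> y \in lev n.+1 ->
    (size (link_class x) <= size (link_class y))%N.
  by move=> an bn; apply/eqP; rewrite eqn_leq !le_size.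
move=> xn yn; have [s <-] := lev_transitive xn yn.
rewrite -(size_map s); apply: uniq_leq_size.
  by rewrite map_inj_uniq ?filter_uniq ?lev_uniq //; apply: fmorph_inj.
move=> w /mapP[z]; rewrite mem_filter => /andP[/asboolP xz zn] ->.
rewrite mem_filter (lev_aut s zn) andbT; apply/asboolP; exact: linked_aut.
Qed.

(** A list closed under [linked] is a disjoint union of classes, which the induction removes one at
    a time. *)
Lemma link_class_dvd m (l : seq algC) : uniq l -> {subset l <= lev n.+1} ->
  {in l, forall a, size (link_class a) = m} ->
  {in l, forall a b, b \in lev n.+1 -> linked a b -> b \in l} -> (m %| size l)%N.
Proof.
have [N] := ubnP (size l); elim: N l => // N IHN [|a l] //.
set L := a :: l => ltN L_uniq Ln Lm Lclosed.
have aL : a \in L by rewrite mem_head.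
have an := Ln _ aL.
have szE : size L = (m + size [seq z <- L | ~~ `[< linked a z >]])%N.
  rewrite -(Lm a aL) -[LHS](count_predC (fun z => `[< linked a z >])) -!size_filter.
  congr (_ + _)%N; apply/perm_size/uniq_perm; rewrite ?filter_uniq ?lev_uniq //.
  move=> z; rewrite !mem_filter; case: asboolP => //= az.
  by apply/idP/idP => [/Ln//|zn]; apply: Lclosed az.
rewrite szE dvdn_addr //; apply: IHN.
- have : a \in link_class a by rewrite mem_filter an andbT; apply/asboolP/linked_refl.
  move: ltN; rewrite szE -(Lm a aL); case: (link_class a) => //= x l' + _; lia.
- exact: filter_uniq.
- by move=> z; rewrite mem_filter => /andP[_ /Ln].
- by move=> z; rewrite mem_filter => /andP[_ /Lm].
- move=> b; rewrite mem_filter => /andP[/asboolP ab bL] c cn bc.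
  rewrite mem_filter (Lclosed b bL c cn bc) andbT; apply/asboolP => ac; apply: ab.
  exact: linked_trans an cn (Ln _ bL) ac (linked_sym bc).
Qed.

Hypothesis transp : exists (a b : algC) (s : {rmorphism algC -> algC}),
    [/\ a \in lev n.+1, b \in lev n.+1, a != b, F a = F b &
        {in lev n.+1, s =1 swap a b}].

Lemma linked_fiber a b : a \in lev n.+1 -> F a = F b -> linked a b.
Proof.
move=> an Fab; have [a0 [b0 [s [a0n b0n ab0 Fab0 Ds]]]] := transp.
have szE x : x \in lev n.+1 -> size (link_class x) = size (link_class a0).
  by move=> xn; apply: size_link_class.
have fibn z : z \in fib (F a) -> z \in lev n.+1.
  by rewrite mem_fib mem_levS => /eqP ->; rewrite -mem_levS.
have fib_un : uniq (fib (F a)) by apply: (@fib_uniq n); rewrite -mem_levS.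
have : (size (link_class a0) %| p)%N.
  rewrite -(size_fib (F a)); apply: link_class_dvd => //.
    by move=> z /fibn; apply: szE.
  by move=> x; rewrite mem_fib => /eqP <- z zn [Fxz _]; rewrite mem_fib Fxz.
(* The class of a0 also contains b0. Its size is thus a divisor of the prime p other than 1, namely
   p, and every class fills its fiber. *)
have gt1 : (1 < size (link_class a0))%N.
  rewrite -[2%N]/(size [:: a0; b0]); apply: uniq_leq_size.
    by rewrite /= inE ab0.
  move=> z; rewrite !inE => /orP[]/eqP->; rewrite mem_filter ?a0n ?b0n andbT; apply/asboolP.
    exact: linked_refl.
  by split => //; exists s.
move/(prime_nt_dvdP p_pr) => szp.
have {}szp : size (link_class a0) = p by apply: szp; rewrite gtn_eqF.
have sub : {subset link_class a <= fib (F a)}.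
  by move=> z; rewrite mem_filter => /andP[/asboolP[Faz _] _]; rewrite mem_fib Faz.
have [||_ memE] := uniq_min_size _ sub.
- by rewrite filter_uniq ?lev_uniq.
- by rewrite size_fib (szE a an) szp.
have : b \in link_class a by rewrite memE mem_fib Fab.
by rewrite mem_filter => /andP[/asboolP].
Qed.

(** Induction on the number of moved points: following g by the transposition of a and g a fixes a
    and moves no new point. *)
Lemma fiber_perm_realized (g : algC -> algC) :
  {in lev n.+1, forall x, F (g x) = F x} -> {in lev n.+1 &, injective g} ->
  exists s : {rmorphism algC -> algC}, {in lev n.+1, s =1 g}.
Proof.
have [N] := ubnP (size [seq x <- lev n.+1 | g x != x]).
elim: N g => // N IHN g; rewrite ltnS => leN Fg g_inj.
have [fix_g|/allPn[a an ga]] := boolP (all (fun x => g x == x) (lev n.+1)).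
  by exists idfun => x /(allP fix_g)/eqP.
pose b := g a; pose g1 x := swap a b (g x).
have Fswap x : F (swap a b x) = F x.
  by rewrite /swap; case: eqP => [->|_]; [rewrite Fg | case: eqP => // ->; rewrite Fg].
have gn x : x \in lev n.+1 -> g x \in lev n.+1.
  by move=> xn; rewrite mem_levS Fg // -mem_levS.
have swapK x : swap a b (swap a b x) = x.
  rewrite {2}/swap; case: eqP => [->|/eqP xa]; first exact: swapR.
  by case: eqP => [->|/eqP xb]; [exact: swapL | exact: swapD].
have [|||s1 Ds1] := IHN g1.
- apply: leq_trans leN; rewrite -[_.+1]/(size (a :: _)); apply: uniq_leq_size.
    by rewrite /= filter_uniq ?lev_uniq // mem_filter /g1 swapR eqxx.
  move=> x; rewrite inE => /predU1P[->|]; first by rewrite mem_filter ga.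
  rewrite mem_filter => /andP[g1x xn]; rewrite mem_filter xn andbT.
  apply: contra_neq g1x => gx; rewrite /g1 gx; apply: swapD.
    by apply: contra_neq ga => <-.
  by apply: contra_neq ga => xb; rewrite -/b -xb; apply: g_inj; rewrite // gx xb.
- by move=> x xn; rewrite Fswap Fg.
- by move=> x y xn yn /(congr1 (swap a b)); rewrite !swapK; apply: g_inj.
have [_ [s Ds]] := linked_fiber an (esym (Fg a an)).
exists (s \o s1)%FUN => x xn /=; rewrite Ds1 // Ds ?swapK //.
by rewrite mem_levS Fswap Fg // -mem_levS.
Qed.

End Level.

(** * Lifting compatible permutations through the levels *)

Hypothesis odd_primes : forall n, exists q : nat, [/\ prime q, ~~ (q %| k * p)%N &
  odd (logn q `|iter n.+1 FZ crit|)].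

Section Tower.
Variable G : nat -> algC -> algC.
Hypotheses (G_lev : forall n, {in lev n, forall x, G n x \in lev n})
  (G_inj : forall n, {in lev n &, injective (G n)})
  (G_Phi : forall n, {in lev n.+1, forall x, F (G n.+1 x) = G n (F x)}).

(** If s0 realizes G on level n, then the inverse of s0 after G preserves the fibers of level n + 1,
    so it is realized there; composing with s0 gives G back. *)
Lemma level_realized n : exists s : {rmorphism algC -> algC}, {in lev n, s =1 G n}.
Proof.
elim: n => [|n [s0 Ds0]].
  exists idfun => x xn; have := G_lev xn.
  by move: xn; rewrite !inE => /eqP -> /eqP ->.
have Fg x : x \in lev n.+1 -> F (algC_invaut s0 (G n.+1 x)) = F x.
  move=> xn; rewrite -rmorph_Phi G_Phi // -Ds0 -?mem_levS //.
  exact: algC_autK.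
have [|s Ds] := @fiber_perm_realized n (lev_transposition (odd_primes n)) _ Fg.
  by move=> x y xn yn /(can_inj (algC_invautK s0)); apply: G_inj.
by exists (s0 \o s)%FUN => x xn /=; rewrite Ds // algC_invautK.
Qed.

(** Agreement descends: every root of a level has a preimage in the next, and both maps commute with
    F. *)
Lemma levels_realized n : exists s : {rmorphism algC -> algC},
  forall m, (m <= n)%N -> {in lev m, s =1 G m}.
Proof.
have [s Ds] := level_realized n; exists s => m le_mn.
rewrite -(subKn le_mn); elim: (n - m)%N => [|j IHj]; first by rewrite subn0.
have [le_nj|lt_jn] := leqP n j.
  by have -> : (n - j.+1 = n - j)%N by lia.
have Dj : (n - j = (n - j.+1).+1)%N by lia.
rewrite Dj in IHj; move: (n - j.+1)%N IHj => i IHi x xi.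
have [y] : exists y, y \in fib x.
  have := size_fib x; case: (fib x) => [|y l] sz; last by exists y; rewrite mem_head.
  by move: (prime_gt0 p_pr); rewrite -sz.
rewrite mem_fib => /eqP Fy; have yi : y \in lev i.+1 by rewrite mem_levS Fy.
by rewrite -Fy rmorph_Phi IHi // G_Phi.
Qed.

End Tower.

(** * Automorphisms of the pre-image tree *)

Local Notation vertex := (tree_vertex phi).

Lemma vertex_lev (v : vertex) : (val v).2 \in lev (val v).1.
Proof. by have := valP v; rewrite lev_polyE root_prod_XsubC. Qed.

Lemma root_origin : root (qbar (iter_poly phi (0%N, 0 : algC).1)) (0%N, 0 : algC).2.
Proof. by rewrite lev_polyE root_prod_XsubC mem_head. Qed.

Definition origin : vertex := exist _ (0%N, 0) root_origin.

(** Outside the level the value defaults to [origin], so statements about it assume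
    [x \in lev n]. *)
Definition vert n x : vertex := insubd origin (n, x).

Lemma val_vert n x : x \in lev n -> val (vert n x) = (n, x).
Proof. by move=> xn; rewrite insubdK // unfold_in /= lev_polyE root_prod_XsubC. Qed.

Lemma vertE (v : vertex) : v = vert (val v).1 (val v).2.
Proof. by apply: val_inj; rewrite val_vert ?vertex_lev //; case: (val v). Qed.

Lemma adj_vert n x : x \in lev n.+1 -> tree_adj (vert n (F x)) (vert n.+1 x).
Proof. by move=> xn; left; rewrite !val_vert -?mem_levS //= horner_qbar. Qed.

Lemma gal_image_tree_aut (f : vertex -> vertex) : gal_image f -> tree_aut f.
Proof.
move=> [s s_bij Df]; have s_inj := fmorph_inj s; split; last first.
  move=> u v; rewrite /tree_adj !Df /= !horner_qbar -!rmorph_Phi.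
  split=> -[[-> D]|[-> D]]; [left|right|left|right]; split=> //;
    by [rewrite D | apply: s_inj].
exists (fun v => vert (val v).1 (algC_invaut s (val v).2)) => v.
  by rewrite Df /= algC_autK -vertE.
apply: val_inj; rewrite Df val_vert /= ?algC_invautK; first by case: (val v).
exact/(lev_aut (algC_invaut s))/vertex_lev.
Qed.

Section Automorphism.
Variable f : vertex -> vertex.
Hypotheses (f_bij : bijective f) (f_adj : forall u v, tree_adj u v <-> tree_adj (f u) (f v)).

(* The origin has p neighbours, every other vertex has p + 1. *)
Lemma tree_aut_origin : (val (f origin)).1 = 0%N.
Proof.
have [g fK gK] := f_bij.
case Dn: (val (f origin)).1 => [//|n]; exfalso.
have := vertex_lev (f origin); rewrite Dn; set x := (val (f origin)).2 => xn.
have Df : f origin = vert n.+1 x by rewrite [LHS]vertE Dn.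
pose L := (n, F x) :: [seq (n.+2, z) | z <- fib x].
have memL u : u \in L -> u.2 \in lev u.1 /\ tree_adj (f origin) (vert u.1 u.2).
  rewrite inE => /predU1P[->|/mapP[z]] /=.
    rewrite -mem_levS; split=> //; rewrite Df.
    have [[h1 h2]|[h1 h2]] := adj_vert xn; [right|left]; by split.
  rewrite mem_fib => /eqP Fz -> /=; rewrite mem_levS Fz; split=> //.
  by rewrite Df -Fz; apply: adj_vert; rewrite mem_levS Fz.
pose w u := val (g (vert u.1 u.2)).
have wP u : u \in L -> w u = (1%N, (w u).2) /\ F (w u).2 = 0.
  move=> /memL[_]; rewrite -{1}(gK (vert _ _)) => /(f_adj _ _).2.
  by rewrite /tree_adj -/(w u) /= horner_qbar; case: (w u) => i y [[/= -> ->]|[]].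
have L_uniq : uniq L.
  rewrite /= map_inj_uniq; last by move=> y z [].
  rewrite (@fib_uniq n.+1) // andbT; apply/mapP => -[z _ []]; lia.
have : (size (map (snd \o w) L) <= size (fib 0%R))%N.
  apply: uniq_leq_size => [|_ /mapP[u uL ->]]; last first.
    by rewrite mem_fib; have [_ /= ->] := wP u uL.
  rewrite map_inj_in_uniq // => u v uL vL /= wuv.
  have : w u = w v by rewrite (wP u uL).1 (wP v vL).1 wuv.
  move=> /val_inj/(can_inj gK)/(congr1 val).
  have [ulev _] := memL u uL; have [vlev _] := memL v vL.
  by rewrite !val_vert //; case: u v {uL vL wuv ulev vlev} => ? ? [].
by rewrite size_map /= size_map !size_fib ltnn.
Qed.

Definition level_fun n x := (val (f (vert n x))).2.

Lemma tree_aut_lev n x : x \in lev n -> val (f (vert n x)) = (n, level_fun n x) /\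
  (forall m, n = m.+1 -> F (level_fun n x) = level_fun m (F x)).
Proof.
have f_inj : injective f := bij_inj f_bij.
elim/ltn_ind: n x => -[|n] IHn x xn.
  split=> //; have -> : x = 0 by move: xn; rewrite inE => /eqP.
  have D0 : vert 0 0 = origin by apply: val_inj; rewrite val_vert ?mem_head.
  by rewrite /level_fun D0; have := tree_aut_origin; case: (val _) => i y /= ->.
have Fxn : F x \in lev n by rewrite -mem_levS.
have [Du Pu] := IHn n (ltnSn n) _ Fxn.
have [[lv Fv]|[lu Fu]] := (f_adj _ _).1 (adj_vert xn).
  move: lv Fv; rewrite Du /= horner_qbar => lv Fv; split.
    by rewrite [LHS]surjective_pairing; congr (_, _).
  by move=> m [<-].
(* In this case f would send x to the parent of the image of F x, which is already the image of F (F
   x); injectivity excludes it, the levels being different. *)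
move: lu Fu; rewrite Du /= horner_qbar; set m := (val _).1 => Dn Fv; exfalso.
have Fm : F (F x) \in lev m by rewrite -mem_levS -Dn.
have lt_m : (m < n.+1)%N by rewrite Dn.
have : vert n.+1 x = vert m (F (F x)).
  apply: f_inj; apply: val_inj; rewrite (IHn m lt_m _ Fm).1 -(Pu m Dn) Fv.
  exact: surjective_pairing.
by move/(congr1 val); rewrite !val_vert // => -[]; lia.
Qed.

Lemma tree_aut_gal_image : gal_image f.
Proof.
have f_inj : injective f := bij_inj f_bij.
have G_lev n : {in lev n, forall x, level_fun n x \in lev n}.
  by move=> x xn; have := vertex_lev (f (vert n x)); rewrite (tree_aut_lev xn).1.
have G_inj n : {in lev n &, injective (level_fun n)}.
  move=> x y xn yn Gxy; have : vert n x = vert n y.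
    by apply: f_inj; apply: val_inj; rewrite (tree_aut_lev xn).1 (tree_aut_lev yn).1 Gxy.
  by move/(congr1 val); rewrite !val_vert // => -[].
have G_Phi n : {in lev n.+1, forall x, F (level_fun n.+1 x) = level_fun n (F x)}.
  by move=> x xn; apply: (tree_aut_lev xn).2.
have [s_ Ds_] := choice (levels_realized G_lev G_inj G_Phi).
(* On a given level the automorphisms [s_ m] agree with f as soon as m reaches that level, so their
   limit realizes f on all levels. *)
have [s Ds] := aut_limit s_; exists s.
  by exists (algC_invaut s); [apply: algC_autK | apply: algC_invautK].
move=> v; have vn := vertex_lev v.
rewrite {1}[v]vertE (tree_aut_lev vn).1; congr (_, _); apply/esym/Ds.
by exists (val v).1 => m le_m; apply: Ds_.
Qed.

End Automorphism.

Lemma full_arboreal_phi : full_arboreal phi.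
Proof.
split=> [n|f]; first exact: separable_iter.
split; first exact: gal_image_tree_aut.
by move=> [f_bij f_adj]; apply: tree_aut_gal_image.
Qed.

End Dynamics.

(** * Reduction to nonsquares in the critical orbit *)

Lemma nonsquare_odd_logn (a : nat) : (forall m, a <> (m ^ 2)%N) ->
  exists2 q, prime q & odd (logn q a).
Proof.
move=> nsq; apply: contrapT => no_q.
have a_gt0 : (0 < a)%N by rewrite lt0n; apply/eqP => a0; apply: (nsq 0%N); rewrite a0.
apply: (nsq (\prod_(q <- primes a) q ^ (logn q a)./2)%N).
rewrite [LHS]prod_prime_decomp // prime_decompE big_map /= -mulnn -big_split /=.
rewrite big_seq [RHS]big_seq; apply: eq_bigr => q; rewrite mem_primes => /and3P[q_pr _ _].
rewrite -expnD addnn halfK; case odd_q: (odd _); last by rewrite subn0.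
by case: no_q; exists q.
Qed.

(* phi(k y) = k psi(y), so k psi^n(1 - p) is the n-th iterate of the critical point. *)
Definition psi (p k : nat) (R : comNzRingType) (y : R) : R :=
  k%:R ^+ p.-1 * y ^+ p.-1 * (y + p%:R) - p%:R.

Lemma rmorph_psi p k (R S : comNzRingType) (g : {rmorphism R -> S}) (y : R) :
  g (psi p k y) = psi p k (g y).
Proof.
by rewrite /psi rmorphB !rmorphM /= !rmorphXn rmorphD /= !rmorph_nat.
Qed.

Lemma iter_crit_psi (p k n : nat) : prime p ->
  iter n (@Phi p k int) (crit p k) = k%:R * iter n (@psi p k int) (- p.-1%:R).
Proof.
move=> p_pr; elim: n => [|n IHn]; first by rewrite /= /crit natrM mulrN.
rewrite !iterS IHn; move: (iter n _ _) => y; rewrite /Phi /psi.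
have expS (x : int) : x ^+ p = x * x ^+ p.-1 by rewrite -exprS prednK ?prime_gt0.
by rewrite expS exprMn natrM; ring.
Qed.

(** Modulo p, [psi] is k^(p-1) y^p, so the orbit of 1 - p stays prime to p; modulo k it is -p. Hence
    a prime of odd exponent in a term of positive index does not divide kp, and the factor k does
    not change that exponent. *)
Lemma full_arboreal_nonsquare (p k : nat) :
    prime p -> (0 < k)%N -> ~~ (p %| k)%N ->
    (forall n m, `|iter n.+1 (@psi p k int) (- p.-1%:R)|%N <> (m ^ 2)%N) ->
  full_arboreal (phi_pk p k).
Proof.
move=> p_pr k_gt0 p_ndvd_k nsq; set y0 : int := - _ in nsq.
have p1_gt0 : (0 < p.-1)%N by rewrite -subn1 subn_gt0 prime_gt1.
have p_ndvd n : ~~ (p %| `|iter n (@psi p k int) y0|)%N.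
  elim: n => [|n]; first by rewrite abszN natz absz_nat gtnNdvd // prednK ?prime_gt0.
  rewrite iterS; move: (iter n _ _) => y; apply: contra => dvd_psi.
  have : (p%:Z %| k%:R ^+ p.-1 * y ^+ p.-1 * (y + p%:R))%Z.
    by rewrite -[X in (_ %| X)%Z](subrK p%:R) rpredD // natz dvdzz.
  rewrite !natz dvdzE !abszM !abszX /= !Euclid_dvdM // !Euclid_dvdX // (negPf p_ndvd_k) /=.
  case/orP => [/andP[]//|]; rewrite -[(p %| _)%N]/((p%:Z %| y + p%:Z)%Z).
  by rewrite rpredDr ?dvdzz.
have A_neq0 n : iter n.+1 (@psi p k int) y0 != 0.
  by apply/eqP => A0; apply: (nsq n 0%N); rewrite A0.
have k_neq0 : k%:R != 0 :> int by rewrite pnatr_eq0 -lt0n.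
apply: full_arboreal_phi => // n.
  by rewrite iter_crit_psi // mulf_neq0.
have [q q_pr q_odd] := nonsquare_odd_logn (nsq n).
have q_dvd : (q %| `|iter n.+1 (@psi p k int) y0|)%N.
  by apply: contraTT q_odd => nd; rewrite lognE (negPf nd) !andbF.
have q_ndvd_p : ~~ (q %| p)%N.
  rewrite dvdn_prime2 //; apply: contraTneq q_dvd => ->; exact: p_ndvd.
have q_ndvd_k : ~~ (q %| k)%N.
  apply: contra q_ndvd_p => qk; move: q_dvd; rewrite iterS; move: (iter n _ _) => y.
  rewrite /psi !natz => q_dvd; rewrite -[(q %| p)%N]/((q%:Z %| p%:Z)%Z).
  rewrite -[p%:Z](subKr (k%:Z ^+ p.-1 * y ^+ p.-1 * (y + p%:Z))) rpredB //.
  by rewrite -mulrA dvdz_mulr // dvdzE abszX /= dvdn_exp.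
exists q; split=> //; first by rewrite Euclid_dvdM // negb_or q_ndvd_k.
rewrite iter_crit_psi // abszM natz absz_nat lognM ?absz_gt0 //.
by rewrite [logn q k]lognE (negPf q_ndvd_k) !andbF.
Qed.

(** * Congruences excluding squares *)

Lemma square_mod_neq (d r m : nat) : (0 < d)%N ->
  [forall x : 'I_d, (x ^ 2 %% d)%N != r] -> (m ^ 2 %% d)%N <> r.
Proof.
move=> d_gt0 /forallP/(_ (Ordinal (ltn_pmod m d_gt0)))/= /eqP.
by rewrite modnXm.
Qed.

(** Positivity makes the residue of a term that of its absolute value. The first term is k^(p-1)
    (p-1)^(p-1) - p, as p - 1 is even; then y > 0 makes the product in [psi] at least y + p. *)
Lemma iter_psi_gt0 (p k n : nat) : (2 < p)%N -> odd p -> (0 < k)%N ->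
  0 < iter n.+1 (@psi p k int) (- p.-1%:R).
Proof.
move=> p_gt2 p_odd k_gt0.
have kX_ge1 : 1 <= (k%:R : int) ^+ p.-1 by rewrite exprn_ege1 // ler1n.
elim: n => [|n IHn].
  rewrite /= /psi subr_gt0.
  have -> : - p.-1%:R + p%:R = 1 :> int by rewrite -{2}(prednK (ltnW (ltnW p_gt2))) -natr1; ring.
  have -> : (- p.-1%:R) ^+ p.-1 = (p.-1 ^ p.-1)%:R :> int.
    rewrite exprNn -signr_odd -natrX; case: p p_odd {p_gt2 kX_ge1} => //= m.
    by move/negPf ->; rewrite mul1r.
  rewrite mulr1 -natrX -natrM ltr_nat.
  have k1 : (1 <= k ^ p.-1)%N by rewrite expn_gt0 k_gt0.
  apply: leq_trans (leq_mul k1 (leqnn _)); rewrite mul1n.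
  apply: (@leq_trans (p.-1 ^ 2)); last by rewrite leq_pexp2l //; lia.
  by rewrite -mulnn; nia.
move: IHn; rewrite [in X in _ -> X]iterS; move: (iter n.+1 _ _) => y y_gt0.
rewrite /psi subr_gt0.
have yX_ge1 : 1 <= y ^+ p.-1 by rewrite exprn_ege1 // -gtz0_ge1.
have y_ge1 : p%:R < y + p%:R by rewrite ltrDr.
apply: (lt_le_trans y_ge1); rewrite ler_peMl ?mulr_ege1 //.
by rewrite ltW // (le_lt_trans _ y_ge1).
Qed.

(** Modulo 3, -1 is a fixed point of [psi]. The start 1 - p is -1 or 0, according as p is 2 or 1,
    and in both cases the first term is -1, a nonsquare. *)
Lemma full_arboreal_mod3 (p k : nat) : prime p -> (5 <= p)%N -> (0 < k)%N ->
  ~~ (p %| k)%N -> (k %% 3)%N = 1%N -> full_arboreal (phi_pk p k).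
Proof.
move=> p_pr p_ge5 k_gt0 p_ndvd_k k1; apply: full_arboreal_nonsquare => // n m.
have p_odd : odd p by have [p2|//] := even_prime p_pr; rewrite p2 in p_ge5.
have even_p1 (x : 'F_3) : (- x) ^+ p.-1 = x ^+ p.-1.
  rewrite exprNn -signr_odd; case: p p_odd {p_pr p_ge5 p_ndvd_k} => //= j.
  by move/negPf ->; rewrite mul1r.
have kF : k%:R = 1 :> 'F_3.
  by apply: val_inj; rewrite /= val_Fp_nat // k1.
have AF : (iter n.+1 (@psi p k int) (- p.-1%:R))%:~R = -1 :> 'F_3.
  have psiN1 : psi p k (-1 : 'F_3) = -1.
    by rewrite /psi even_p1 kF !expr1n; ring.
  elim: n => [|n IHn]; last by rewrite iterS rmorph_psi /= IHn.
  rewrite [iter _ _ _]/= rmorph_psi rmorphN rmorph_nat /=.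
  have pE : p%:R = p.-1%:R + 1 :> 'F_3 by rewrite natr1 prednK ?prime_gt0.
  have p1_neq0 : (p.-1 == 0)%N = false by apply/eqP; lia.
  have : p.-1%:R = 0 :> 'F_3 \/ p.-1%:R = 1 :> 'F_3.
    have : (p %% 3 != 0)%N.
      by rewrite -/(3 %| p)%N dvdn_prime2 //; apply/eqP; lia.
    have : (p %% 3 < 3)%N by rewrite ltn_mod.
    case Dp: (p %% 3)%N => [|[|[|]]] // _ _; [left|right]; apply: (addIr 1);
      by rewrite -pE; apply: val_inj; rewrite /= val_Fp_nat // Dp.
  case => Dp1; rewrite /psi even_p1 kF pE Dp1 expr1n ?expr1n.
    by rewrite expr0n p1_neq0 /=; ring.
  by ring.
have A_gt0 := @iter_psi_gt0 p k n (ltnW (ltnW p_ge5)) p_odd k_gt0.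
move: AF A_gt0; move: (iter _ _ _) => -[a|//] /= AF _ am.
apply: (@square_mod_neq 3 2 m) => //.
  by apply/forallP => -[[|[|[|]]]].
move/(congr1 val): AF; rewrite am -[_%:~R]/((m ^ 2)%N%:R) /= val_Fp_nat //.
Qed.

Lemma full_arboreal_3_2 : full_arboreal (phi_pk 3 2).
Proof.
apply: full_arboreal_nonsquare => // n m.
have [t ->] : exists t : nat, iter n.+1 (@psi 3 2 int) (- (3.-1)%:R) = (8 * t + 5)%N.
  elim: n => [|n [t Dt]]; first by exists 1%N.
  (* With y = 8t + 5, y + 3 = 8(t + 1) and [psi] takes the value 32 y^2 (t + 1) - 3; the predecessor
     absorbs -3 = 5 - 8. *)
  rewrite iterS Dt; exists (4 * (8 * t + 5) ^ 2 * t + (4 * (8 * t + 5) ^ 2).-1)%N.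
  rewrite /psi /=; nia.
rewrite absz_nat => am; apply: (@square_mod_neq 8 5 m) => //.
  by apply/forallP => -[[|[|[|[|[|[|[|[|]]]]]]]]].
by rewrite -am; lia.
Qed.

Lemma full_arboreal_2_3 : full_arboreal (phi_pk 2 3).
Proof.
apply: full_arboreal_nonsquare => // -[|n] m.
  (* The first term is -5, whose absolute value is 1 modulo 4; it is excluded modulo 3. The next
     term is 43 = 4 * 10 + 3, where the induction modulo 4 begins. *)
  have -> : `|iter 1 (@psi 2 3 int) (- (2.-1)%:R)|%N = 5 by [].
  move=> m5; apply: (@square_mod_neq 3 2 m) => //; last by rewrite -m5.
  by apply/forallP => -[[|[|[|]]]].
have [t ->] : exists t : nat, iter n.+2 (@psi 2 3 int) (- (2.-1)%:R) = (4 * t + 3)%N.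
  elim: n => [|n [t Dt]]; first by exists 10%N.
  (* With y = 4t + 3, 3 y (y + 2) - 2 = 48 t^2 + 96 t + 43. *)
  rewrite iterS Dt; exists (12 * t ^ 2 + 24 * t + 10)%N.
  rewrite /psi /=; nia.
rewrite absz_nat => am; apply: (@square_mod_neq 4 3 m) => //.
  by apply/forallP => -[[|[|[|[|]]]]].
by rewrite -am; lia.
Qed.

Local Close Scope ring_scope.
Local Close Scope classical_set_scope.

(** * A polynomial in each prime degree *)

Theorem theorem1p2 :
  (forall p k : nat, prime p -> (5 <= p)%N -> (0 < k)%N -> ~~ (p %| k)%N ->
     k %% 3 = 1%N -> full_arboreal (phi_pk p k)) /\
  full_arboreal (phi_pk 3 2) /\
  (forall l : nat, prime l ->
     exists phi : {poly int}, size phi = l.+1 /\ full_arboreal phi).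
Proof.
split; first exact: full_arboreal_mod3.
split; first exact: full_arboreal_3_2.
suff ex_k l : prime l -> exists k, full_arboreal (phi_pk l k).
  move=> l l_pr; have [k fullk] := ex_k l l_pr; exists (phi_pk l k); split => //.
  rewrite -(size_map_inj_poly (f := intr : int -> algC)) //; last exact: intr_inj.
  by have := (monic_fiber_poly k l_pr 0%R).2; rewrite subr0.
move=> l_pr; have [l5|] := leqP 5 l.
  (* The value k = 1 is 1 modulo 3 and prime to every l. *)
  by exists 1%N; apply: full_arboreal_mod3 => //; rewrite dvdn1 gtn_eqF // prime_gt1.
case: l l_pr => [|[|[|[|[|l]]]]] // _ _; first by exists 3; exact: full_arboreal_2_3.
by exists 2; exact: full_arboreal_3_2.
Qed.
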